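(* Let $n$ be a positive integer, $N=n^2$, $\sigma>0$, $\theta^* \in \mathbb{R}^{n\times n}$, and observe $y = \theta^* + \sigma Z$ where $Z$ has i.i.d. standard normal entries. Let $k = k(\theta^* )$ and let $R_1,\dots,R_k$ be the rectangular level sets of $\theta^*$ forming a partition of $[n]\times[n]$ (a minimal partition into rectangles on each of which $\theta^*$ is constant). Assume there is a constant $c>0$ with $\max_{i\in[k]} A(R_i) \le c$. Then, with $\mathbf{V}^* = \mathrm{TV}_{\mathrm{norm}}(\theta^* )$, $$\mathrm{MSE}(\hat\theta_{\mathbf{V}^*},\theta^* ) \leq C \sigma^2 (\log (e n))^{9} \frac{k(\theta^* )^{5/4}}{N^{3/4}},$$ where $C$ is a constant depending only on $c$.
   Context: $L_n$ is the $n\times n$ grid graph on $[n]\times[n]$ with edge set $E_n$ (pairs at $\ell_1$-distance 1). $\mathrm{TV}_{\mathrm{norm}}(\theta) = \frac{1}{n}\sum_{(u,v)\in E_n}|\theta_u - \theta_v|$. The constrained TVD estimator is $\hat\theta_{\mathbf{V}} = \operatorname{argmin}_{\theta: \mathrm{TV}_{\mathrm{norm}}(\theta)\le \mathbf{V}} \|y - \theta\|^2$ (Frobenius norm), and $\mathrm{MSE}(\hat\theta,\theta^* ) = \mathbb{E}\|\hat\theta - \theta^*\|^2/N$. A (axis-aligned) rectangle is a set $R = ([a,b]\cap\mathbb{N})\times([c',d]\cap\mathbb{N}) \subseteq [n]\times[n]$; $\mathrm{nrow}(R)$ and $\mathrm{ncol}(R)$ are its numbers of rows and columns and its aspect ratio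 is $A(R) = \max\{\mathrm{nrow}(R)/\mathrm{ncol}(R), \mathrm{ncol}(R)/\mathrm{nrow}(R)\}$. $k(\theta)$ is the cardinality of a minimal partition of $[n]\times[n]$ into rectangles on each of which $\theta$ is constant. *)

(* Defs.v *)
From HB Require Import structures.
From mathcomp Require Import all_boot all_order all_algebra.
From mathcomp Require Import all_classical all_reals all_analysis.
Set Implicit Arguments. Unset Strict Implicit. Unset Printing Implicit Defensive.
Import Order.TTheory GRing.Theory Num.Theory.
Import numFieldNormedType.Exports.
Local Open Scope ring_scope.

Notation cell n := ('I_n * 'I_n)%type.

Definition frob2 {R : realType} {n : nat} (A : 'M[R]_n) : R :=
  \sum_(i < n) \sum_(j < n) (A i j) ^+ 2.

(* Edges of the grid graph L_n: pairs of cells at l1-distance 1, each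
   unordered edge counted once (oriented from smaller to larger index). *)
Definition grid_edge {n : nat} (u v : cell n) : bool :=
  ((u.1 == v.1 :> nat) && (v.2 == u.2.+1 :> nat)) ||
  ((u.2 == v.2 :> nat) && (v.1 == u.1.+1 :> nat)).

Definition TVnorm {R : realType} {n : nat} (th : 'M[R]_n) : R :=
  n%:R^-1 * \sum_(u : cell n) \sum_(v : cell n | grid_edge u v)
                `|th u.1 u.2 - th v.1 v.2|.

Definition is_rect {n : nat} (S : cell n -> Prop) (a b c d : nat) : Prop :=
  [/\ a <= b < n, c <= d < n &
      forall x : cell n, S x <-> ((a <= x.1 <= b) && (c <= x.2 <= d))]%N.

Definition aspect {R : realType} (a b c d : nat) : R :=
  let nr := (b - a).+1 in let nc := (d - c).+1 in
  Num.max (nr%:R / nc%:R) (nc%:R / nr%:R).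

(* lab : cell n -> 'I_m encodes a partition of [n]x[n] into m (nonempty)
   rectangles (the label classes), on each of which th is constant. *)
Definition const_rect_partition {R : realType} {n m : nat} (th : 'M[R]_n)
  (lab : cell n -> 'I_m) : Prop :=
  (forall l : 'I_m, exists a b c d, is_rect (fun x => lab x = l) a b c d) /\
  (forall x y : cell n, lab x = lab y -> th x.1 x.2 = th y.1 y.2).

Lemma exists_const_rect_partition {R : realType} {n : nat} (th : 'M[R]_n) :
  exists m, `[< exists lab : cell n -> 'I_m, const_rect_partition th lab >].
Proof.
exists #|{: cell n}|; apply/asboolP; exists enum_rank; split.
- move=> l; set x0 := enum_val l.
  exists x0.1, x0.1, x0.2, x0.2; split; rewrite ?leqnn ?ltn_ord //.
  move=> x; split.
  + by move=> e; rewrite /x0 -e enum_rankK !leqnn.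
  + move=> /andP[/andP[h1 h2] /andP[h3 h4]].
    have e1 : x.1 = x0.1 by apply: val_inj; apply/eqP; rewrite eqn_leq h1 h2.
    have e2 : x.2 = x0.2 by apply: val_inj; apply/eqP; rewrite eqn_leq h3 h4.
    have -> : x = x0 by case: x e1 e2 {h1 h2 h3 h4} => ? ? /= -> ->; rewrite -surjective_pairing.
    by rewrite /x0 enum_valK.
- by move=> x y /enum_rank_inj ->.
Qed.

Definition kpart {R : realType} {n : nat} (th : 'M[R]_n) : nat :=
  ex_minn (exists_const_rect_partition th).

Fixpoint gauss_iter {R : realType} {T : eqType} (s : seq T)
  (f : (T -> R) -> \bar R) (z : T -> R) : \bar R :=
  if s is x :: s' then
    (\int[@lebesgue_measure R]_(t in [set: R])
        ((normal_pdf 0 1 t)%:E *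
         gauss_iter s' f (fun y => if y == x then t else z y)))%E
  else f z.

(* E[f(Z)] for Z = (Z_x)_{x in T} with i.i.d. N(0,1) entries. *)
Definition gauss_expect {R : realType} (T : finType) (f : (T -> R) -> \bar R)
  : \bar R := gauss_iter (enum T) f (fun _ => 0).

Definition observe {R : realType} {n : nat} (th : 'M[R]_n) (sigma : R)
  (z : cell n -> R) : 'M[R]_n :=
  \matrix_(i, j) (th i j + sigma * z (i, j)).

Definition is_constrained_TVD {R : realType} {n : nat} (V : R)
  (est : 'M[R]_n -> 'M[R]_n) : Prop :=
  forall y : 'M[R]_n, TVnorm (est y) <= V /\
    forall th : 'M[R]_n, TVnorm th <= V -> frob2 (y - est y) <= frob2 (y - th).

Definition MSE {R : realType} {n : nat} (est : 'M[R]_n -> 'M[R]_n)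
  (th : 'M[R]_n) (sigma : R) : \bar R :=
  ((n ^ 2)%:R^-1)%:E *
  gauss_expect (fun z => (frob2 (est (observe th sigma z) - th))%:E).

(* Main.v *)
Require Import Defs.
From HB Require Import structures.
From mathcomp Require Import all_boot all_order all_algebra.
From mathcomp Require Import all_classical all_reals all_analysis.
From mathcomp Require Import measurable_realfun.
From mathcomp Require Import zify ring lra.
Import Order.TTheory GRing.Theory Num.Theory.
Local Open Scope ring_scope.
Set Implicit Arguments.
Unset Strict Implicit.

(** Write [D] for the error of the estimator.  Minimality gives
    [|D|^2 <= 2 sigma <Z, D>].  Since [D] does not increase the total variation
    of [thstar], the variation of [D] inside the rectangles of the partition is
    at most the l1 norm of [D] on the sides of the rectangles.  In a rectangle
    [Q] of bounded aspect ratio some middle row and some middle column have l1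
    norm [O(|D|_Q)]; hence the variation of [D] exceeds by very little what is
    needed to go down from the sides to the middle.  This excess is
    [O(sum_Q |D|_Q) = O(sqrt k |D|)] in total.

    Consequently, in a block of [h] rows and [w] columns that is at distance at
    least [h] from the horizontal sides and [w] from the vertical ones, the
    variation along rows is at most [sqrt (h / w) |D|_Q] plus the excess, and the
    one along columns at most [sqrt (w / h) |D|_Q] plus the excess.  An anisotropic
    Haar decomposition of such a block, with cells of proportions
    [1 : sqrt (w / h)], bounds [<Z, D>] there by [n^(1/4) (|D|_Q + excess)] up to a
    logarithm and the maximum [M] of the normalised sums of [Z] over blocks.  Each
    rectangle is a union of [O(log^2 n)] such blocks, so
    [|D|^2 <= C sigma^2 M^2 log^6 n k n^(1/2)].  Finally [E M^2 = O(log^2 n)],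
    because [M^2] is bounded by an explicit sum of exponentials of linear forms. *)

(** * Block sums and the Haar decomposition *)

(* The window [j, j + w) contains [w] points, hence [w.-1] increments. *)
Definition var (R : rcfType) (u : nat -> R) (j w : nat) : R :=
  \sum_(j <= k < j + w.-1) `|u k.+1 - u k|.

Definition blocksum (R : rcfType) (f : nat -> nat -> R) (i r j w : nat) : R :=
  \sum_(i <= p < i + r) \sum_(j <= q < j + w) f p q.

Definition blockvar (R : rcfType) (f : nat -> nat -> R) (i r j w : nat) : R :=
  \sum_(i <= p < i + r) var (f p) j w.

Definition transp (R : rcfType) (f : nat -> nat -> R) : nat -> nat -> R :=
  fun p q => f q p.

(** The inner product of [z] and [f] after removal of their block means: a covariance times the
    number of cells. *)
Definition blockosc (R : rcfType) (z f : nat -> nat -> R) (i r j w : nat) : R :=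
  blocksum (fun p q => z p q * f p q) i r j w
  - blocksum z i r j w * blocksum f i r j w / (r%:R * w%:R).

(** The factor beside [M] is the standard deviation of the sum of a white noise over the block. All
    randomness enters the deterministic part of the argument through this [M]. *)
Definition block_bounded (R : rcfType) (n : nat) (z : nat -> nat -> R) (M : R) :=
  forall i r j w, (i + r <= n)%N -> (j + w <= n)%N ->
    `|blocksum z i r j w| <= M * Num.sqrt (r%:R * w%:R).

Lemma var_ge0 (R : rcfType) (u : nat -> R) j w : 0 <= var u j w.
Proof. by apply: sumr_ge0. Qed.

Lemma blockvar_ge0 (R : rcfType) (f : nat -> nat -> R) i r j w :
  0 <= blockvar f i r j w.
Proof. by apply: sumr_ge0 => p _; exact: var_ge0. Qed.

Lemma sum_nat_split (R : rcfType) (g : nat -> R) a m b : (a <= m <= b)%N ->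
  \sum_(a <= k < b) g k = \sum_(a <= k < m) g k + \sum_(m <= k < b) g k.
Proof. by case/andP=> h1 h2; rewrite (big_cat_nat h1 h2). Qed.

Lemma sum_nat_subrange (R : rcfType) (g : nat -> R) a b a' b' :
  (forall k, 0 <= g k) -> (a <= a')%N -> (b' <= b)%N ->
  \sum_(a' <= k < b') g k <= \sum_(a <= k < b) g k.
Proof.
move=> g0 ha hb; have [hab|hab] := leqP b' a'.
  by rewrite big_geq // sumr_ge0.
rewrite (@sum_nat_split _ _ a a' b); last by lia.
rewrite (@sum_nat_split _ _ a' b' b); last by lia.
rewrite addrCA lerDl addr_ge0 // sumr_ge0 //.
Qed.

Lemma dist_le_sum (R : rcfType) (u : nat -> R) a b : (a <= b)%N ->
  `|u b - u a| <= \sum_(a <= k < b) `|u k.+1 - u k|.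
Proof.
move=> hab; rewrite -(telescope_sumr u hab); exact: ler_norm_sum.
Qed.

Lemma dist_le_var (R : rcfType) (u : nat -> R) j w a b :
  (j <= a)%N -> (a <= b)%N -> (b < j + w)%N -> `|u b - u a| <= var u j w.
Proof.
move=> h1 h2 h3; apply: le_trans (dist_le_sum u h2) _.
by apply: sum_nat_subrange => //; lia.
Qed.

(** The increment across the junction belongs to neither window, hence an inequality. *)
Lemma var_cat (R : rcfType) (u : nat -> R) j w w' :
  var u j w + var u (j + w) w' <= var u j (w + w').
Proof.
case: w => [|w]; first by rewrite add0n addn0 {1}/var /= addn0 big_geq // add0r.
case: w' => [|w']; first by rewrite addn0 /var /= addn0 (@big_geq _ _ _ (j + w.+1)) // addr0.
rewrite /var [leRHS](@sum_nat_split _ _ j (j + w)); last by lia.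
rewrite lerD2l; apply: sum_nat_subrange => //; lia.
Qed.

Lemma blockvar_catw (R : rcfType) (f : nat -> nat -> R) i r j w w' :
  blockvar f i r j w + blockvar f i r (j + w) w' <= blockvar f i r j (w + w').
Proof. by rewrite /blockvar -big_split /=; apply: ler_sum => p _; exact: var_cat. Qed.

Lemma blockvar_catr (R : rcfType) (f : nat -> nat -> R) i r r' j w :
  blockvar f i r j w + blockvar f (i + r) r' j w = blockvar f i (r + r') j w.
Proof.
rewrite /blockvar (@sum_nat_split _ _ i (i + r) (i + (r + r'))); last by lia.
by rewrite addnA.
Qed.

Lemma blocksum_catw (R : rcfType) (f : nat -> nat -> R) i r j w w' :
  blocksum f i r j (w + w') = blocksum f i r j w + blocksum f i r (j + w) w'.
Proof.
rewrite /blocksum -big_split /=; apply: eq_bigr => p _.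
rewrite (@sum_nat_split _ _ j (j + w) (j + (w + w'))); last by lia.
by rewrite addnA.
Qed.

Lemma blocksum_transp (R : rcfType) (f : nat -> nat -> R) i r j w :
  blocksum (transp f) j w i r = blocksum f i r j w.
Proof. by rewrite /blocksum exchange_big_nat. Qed.

Lemma blockosc_transp (R : rcfType) (z f : nat -> nat -> R) i r j w :
  blockosc (transp z) (transp f) j w i r = blockosc z f i r j w.
Proof.
rewrite /blockosc (blocksum_transp z) (blocksum_transp f) (mulrC w%:R); congr (_ - _).
exact: (blocksum_transp (fun p q => z p q * f p q)).
Qed.

Lemma block_bounded_transp (R : rcfType) n (z : nat -> nat -> R) M :
  block_bounded n z M -> block_bounded n (transp z) M.
Proof. by move=> H i r j w hi hj; rewrite (blocksum_transp z) (mulrC r%:R); exact: H. Qed.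

(** Pair each point of the first half with its translate by [w]: each of the [w] differences is at
    most the variation of the whole window. *)
Lemma half_sums_close (R : rcfType) (u : nat -> R) j w :
  `|\sum_(j <= k < j + w) u k - \sum_(j + w <= k < j + w + w) u k|
  <= w%:R * var u j (w + w).
Proof.
have -> : \sum_(j + w <= k < j + w + w) u k = \sum_(j <= k < j + w) u (k + w)%N.
  by rewrite big_addn addnK.
rewrite -sumrB; apply: le_trans (ler_norm_sum _ _ _) _.
have -> : w%:R * var u j (w + w) = \sum_(j <= k < j + w) var u j (w + w).
  by rewrite sumr_const_nat addKn mulr_natl.
rewrite big_nat_cond [leRHS]big_nat_cond; apply: ler_sum => k /andP[/andP[h1 h2] _].
by rewrite distrC; apply: dist_le_var; lia.
Qed.

(** Halving changes the covariance by exactly one product of Haar coefficients,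
    [(Z1 - Z2) * (S1 - S2) / (2 * r * w)]. The noise factor is at most [2 * M * sqrt (r * w)]; the
    other one is controlled by [half_sums_close] in each row. *)
Lemma blockosc_splitw (R : rcfType) n (z f : nat -> nat -> R) M i r j w :
  block_bounded n z M -> (0 < r)%N -> (0 < w)%N ->
  (i + r <= n)%N -> (j + (w + w) <= n)%N ->
  `|blockosc z f i r j (w + w)| <=
    `|blockosc z f i r j w| + `|blockosc z f i r (j + w) w|
    + M * Num.sqrt (w%:R / r%:R) * blockvar f i r j (w + w).
Proof.
move=> hz r0 w0 hi hj.
have rR : 0 < r%:R :> R by rewrite ltr0n.
have wR : 0 < w%:R :> R by rewrite ltr0n.
have hZ1 := hz i r j w hi ltac:(lia).
have hZ2 := hz i r (j + w)%N w hi ltac:(lia).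
have hS : `|blocksum f i r j w - blocksum f i r (j + w) w|
    <= w%:R * blockvar f i r j (w + w).
  rewrite /blocksum /blockvar -sumrB mulr_sumr.
  apply: le_trans (ler_norm_sum _ _ _) _; apply: ler_sum => p _.
  exact: half_sums_close.
set S1 := blocksum f i r j w in hS *; set S2 := blocksum f i r (j + w) w in hS *.
set Z1 := blocksum z i r j w in hZ1 *; set Z2 := blocksum z i r (j + w) w in hZ2 *.
set V := blockvar _ _ _ _ _ in hS *.
have E : blockosc z f i r j (w + w) = blockosc z f i r j w + blockosc z f i r (j + w) w
    + (Z1 - Z2) * (S1 - S2) / (2 * r%:R * w%:R).
  rewrite /blockosc !blocksum_catw -/Z1 -/Z2 -/S1 -/S2 natrD.
  field; rewrite ?gt_eqF ?rR ?wR ?addr_gt0 ?mulr_gt0 //.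
rewrite E; apply: le_trans (ler_normD _ _) _; apply: lerD; first exact: ler_normD.
set D := Num.sqrt (r%:R * w%:R) in hZ1 hZ2.
have hD : Num.sqrt (w%:R / r%:R) = D / r%:R.
  have -> : w%:R / r%:R = (r%:R * w%:R) / r%:R ^+ 2 :> R by field; rewrite gt_eqF.
  by rewrite sqrtrM ?mulr_ge0 ?ler0n // sqrtrV ?sqr_ge0 // sqrtr_sqr gtr0_norm.
have M0 : 0 <= M * D by exact: le_trans (normr_ge0 _) hZ1.
have h12 : `|Z1 - Z2| <= 2 * (M * D).
  by apply: le_trans (ler_normB _ _) _; rewrite mulr_natl mulr2n; apply: lerD.
rewrite !normrM normfV (gtr0_norm (_ : 0 < 2 * r%:R * w%:R)) ?mulr_gt0 //.
rewrite ler_pdivrMr ?mulr_gt0 //.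
apply: le_trans (ler_pM _ _ h12 hS) _ => //.
rewrite hD le_eqVlt; apply/orP; left; apply/eqP; field; rewrite gt_eqF //.
Qed.

Lemma blockosc_splitr (R : rcfType) n (z f : nat -> nat -> R) M i r j w :
  block_bounded n z M -> (0 < r)%N -> (0 < w)%N ->
  (i + (r + r) <= n)%N -> (j + w <= n)%N ->
  `|blockosc z f i (r + r) j w| <=
    `|blockosc z f i r j w| + `|blockosc z f (i + r) r j w|
    + M * Num.sqrt (r%:R / w%:R) * blockvar (transp f) j w i (r + r).
Proof.
move=> /block_bounded_transp hz r0 w0 hi hj.
have := blockosc_splitw (transp f) hz w0 r0 hj hi.
by rewrite !(blockosc_transp z f).
Qed.

Lemma blockosc1 (R : rcfType) (z f : nat -> nat -> R) i j : blockosc z f i 1 j 1 = 0.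
Proof. by rewrite /blockosc /blocksum !addn1 !big_nat1 mulr1 divr1 subrr. Qed.

(** After [s] rounds of halving only single cells remain, where the covariance vanishes. Each round
    costs at most [M * sqrt (2 ^ s)] times the variation, because the variations of the pieces add
    up to at most that of the row. *)
Lemma blockosc_row (R : rcfType) n (z f : nat -> nat -> R) M s i j :
  0 <= M -> block_bounded n z M -> (i + 1 <= n)%N -> (j + 2 ^ s <= n)%N ->
  `|blockosc z f i 1 j (2 ^ s)| <=
    M * s%:R * Num.sqrt (2 ^+ s) * blockvar f i 1 j (2 ^ s).
Proof.
move=> M0 hz hi; elim: s j => [|s IH] j hj.
  by rewrite expn0 blockosc1 normr0 !mulr_ge0 ?sqrtr_ge0 ?blockvar_ge0.
have e : (2 ^ s.+1 = 2 ^ s + 2 ^ s)%N by rewrite expnS mul2n addnn.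
rewrite e in hj *.
have w0 : (0 < 2 ^ s)%N by rewrite expn_gt0.
apply: le_trans (blockosc_splitw f hz _ w0 hi hj) _ => //.
have h1 := IH j ltac:(lia); have h2 := IH (j + 2 ^ s)%N ltac:(lia).
have hc := blockvar_catw f i 1 j (2 ^ s) (2 ^ s).
set V := blockvar f i 1 j (2 ^ s + 2 ^ s) in hc *.
have hP : Num.sqrt (2 ^+ s) <= Num.sqrt (2 ^+ s.+1) :> R.
  by apply: ler_wsqrtr; rewrite exprS ler_peMl ?exprn_ge0 // ler1n.
rewrite invr1 mulr1 natrX -[s.+1%:R]nat1r.
set P := Num.sqrt (2 ^+ s) in h1 h2 hP *; set Q := Num.sqrt (2 ^+ s.+1) in hP *.
apply: (@le_trans _ _ (M * s%:R * P * V + M * P * V)).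
  rewrite lerD2r; apply: le_trans (lerD h1 h2) _.
  by rewrite -mulrDr ler_wpM2l // !mulr_ge0 // ?sqrtr_ge0.
have -> : M * s%:R * P * V + M * P * V = M * (1 + s%:R) * V * P by ring.
have -> : M * (1 + s%:R) * Q * V = M * (1 + s%:R) * V * Q by ring.
by apply: ler_wpM2l => //; rewrite !mulr_ge0 ?blockvar_ge0 // addr_ge0.
Qed.

(** Halving both directions keeps the proportions [1 : 2 ^ s]; after [t] rounds the pieces are
    single rows, left to [blockosc_row]. A cut of the width costs the variation along rows times at
    most [P], a cut of the height the variation along columns times [P^-1]. *)
Lemma blockosc_tile (R : rcfType) n (z f : nat -> nat -> R) M s t i j :
  0 <= M -> block_bounded n z M ->
  (i + 2 ^ t <= n)%N -> (j + 2 ^ (t + s) <= n)%N ->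
  `|blockosc z f i (2 ^ t) j (2 ^ (t + s))| <=
    M * (t + s)%:R * (Num.sqrt (2 ^+ s) * blockvar f i (2 ^ t) j (2 ^ (t + s))
      + (Num.sqrt (2 ^+ s))^-1 * blockvar (transp f) j (2 ^ (t + s)) i (2 ^ t)).
Proof.
move=> M0 hz; set P := Num.sqrt (2 ^+ s).
have P0 : 0 < P by rewrite sqrtr_gt0 exprn_gt0.
elim: t i j => [|t IH] i j hi hj.
  rewrite add0n expn0; apply: le_trans (blockosc_row f M0 hz hi hj) _.
  rewrite -mulrA ler_wpM2l ?mulr_ge0 // lerDl mulr_ge0 ?blockvar_ge0 //.
  by rewrite invr_ge0 ltW.
have e1 : (2 ^ t.+1 = 2 ^ t + 2 ^ t)%N by rewrite expnS mul2n addnn.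
have e2 : (2 ^ (t.+1 + s) = 2 ^ (t + s) + 2 ^ (t + s))%N.
  by rewrite addSn expnS mul2n addnn.
have r0 : (0 < 2 ^ t.+1)%N by rewrite expn_gt0.
have r1 : (0 < 2 ^ t)%N by rewrite expn_gt0.
have w0 : (0 < 2 ^ (t + s))%N by rewrite expn_gt0.
rewrite e2 in hj *.
apply: le_trans (blockosc_splitw f hz r0 w0 hi hj) _.
rewrite e1 in hi *.
have ha : Num.sqrt ((2 ^ t)%:R / (2 ^ (t + s))%:R) = P^-1 :> R.
  rewrite -sqrtrV ?exprn_ge0 //; congr Num.sqrt.
  rewrite !natrX exprD; field; rewrite !gt_eqF ?exprn_gt0 //.
(* The width is cut while the block still has [2 ^ t.+1] rows, so the ratio is half of [2 ^ s]. *)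
have hb : Num.sqrt ((2 ^ (t + s))%:R / (2 ^ t + 2 ^ t)%:R) <= P :> R.
  apply: ler_wsqrtr; rewrite natrD !natrX exprD ler_pdivrMr ?addr_gt0 ?exprn_gt0 //.
  by rewrite mulrC ler_wpM2l ?exprn_ge0 // lerDl exprn_ge0.
have s1 := @blockosc_splitr _ n z f M i (2 ^ t) j (2 ^ (t + s)) hz r1 w0 hi ltac:(lia).
have s2 := @blockosc_splitr _ n z f M i (2 ^ t) (j + 2 ^ (t + s)) (2 ^ (t + s))
  hz r1 w0 hi ltac:(lia).
rewrite ha in s1 s2.
have q1 := IH i j ltac:(lia) ltac:(lia).
have q2 := IH i (j + 2 ^ (t + s))%N ltac:(lia) ltac:(lia).
have q3 := IH (i + 2 ^ t)%N j ltac:(lia) ltac:(lia).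
have q4 := IH (i + 2 ^ t)%N (j + 2 ^ (t + s))%N ltac:(lia) ltac:(lia).
have v1 := blockvar_catr (transp f) j (2 ^ (t + s)) (2 ^ (t + s)) i (2 ^ t + 2 ^ t).
have v2 := blockvar_catw (transp f) j (2 ^ (t + s)) i (2 ^ t) (2 ^ t).
have v3 := blockvar_catw (transp f) (j + 2 ^ (t + s)) (2 ^ (t + s)) i (2 ^ t) (2 ^ t).
have u1 := blockvar_catr f i (2 ^ t) (2 ^ t) j (2 ^ (t + s) + 2 ^ (t + s)).
have u2 := blockvar_catw f i (2 ^ t) j (2 ^ (t + s)) (2 ^ (t + s)).
have u3 := blockvar_catw f (i + 2 ^ t) (2 ^ t) j (2 ^ (t + s)) (2 ^ (t + s)).
have U0 := blockvar_ge0 f i (2 ^ t + 2 ^ t) j (2 ^ (t + s) + 2 ^ (t + s)).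
set U := blockvar f i (2 ^ t + 2 ^ t) j (2 ^ (t + s) + 2 ^ (t + s)) in u1 U0 *.
set W := blockvar (transp f) j (2 ^ (t + s) + 2 ^ (t + s)) i (2 ^ t + 2 ^ t) in v1 *.
have Pi0 : 0 <= P^-1 by rewrite invr_ge0 ltW.
rewrite addSn -[(t + s).+1%:R]nat1r.
have A : `|blockosc z f i (2 ^ t + 2 ^ t) j (2 ^ (t + s))| +
    `|blockosc z f i (2 ^ t + 2 ^ t) (j + 2 ^ (t + s)) (2 ^ (t + s))| <=
    M * (t + s)%:R * (P * U + P^-1 * W) + M * P^-1 * W.
  apply: le_trans (lerD s1 s2) _.
  apply: le_trans (lerD (lerD (lerD q1 q3) (lexx _)) (lerD (lerD q2 q4) (lexx _))) _.
  (* Arithmetic of the four quarters: the [x] and [y] stand for their variations along rows and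
     columns, [Y1] and [Y2] for the column variations paid by the two cuts of the height. *)
  have comb (k Q x1 x2 x3 x4 y1 y2 y3 y4 Y1 Y2 : R) : 0 <= k -> 0 <= Q ->
      x1 + x3 + (x2 + x4) <= U -> y1 + y3 + (y2 + y4) <= W -> Y1 + Y2 = W ->
      k * (P * x1 + Q * y1) + k * (P * x3 + Q * y3) + M * Q * Y1
      + (k * (P * x2 + Q * y2) + k * (P * x4 + Q * y4) + M * Q * Y2)
      <= k * (P * U + Q * W) + M * Q * W.
    move=> k0 Q0 hx hy hY; rewrite -{2}hY [leLHS](_ : _ =
      k * (P * (x1 + x3 + (x2 + x4)) + Q * (y1 + y3 + (y2 + y4))) + M * Q * (Y1 + Y2));
      last by ring.
    by rewrite lerD2r ler_wpM2l // lerD // ler_wpM2l // ltW.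
  apply: comb => //; first by rewrite mulr_ge0.
    by rewrite -u1; lra.
  by move: v2 v3; lra.
apply: le_trans (lerD A (ler_wpM2r U0 (ler_wpM2l M0 hb))) _.
by rewrite le_eqVlt; apply/orP; left; apply/eqP; ring.
Qed.

(** * Norms of blocks, Cauchy-Schwarz, and the bound for one dyadic block *)

Definition blocknorm (R : rcfType) (f : nat -> nat -> R) (i r j w : nat) : R :=
  Num.sqrt (blocksum (fun p q => f p q ^+ 2) i r j w).

(** Cauchy-Schwarz against the constant 1. *)
Lemma sum_sqr_le (R : rcfType) (I : Type) (s : seq I) (x : I -> R) :
  (\sum_(k <- s) x k) ^+ 2 <= (size s)%:R * \sum_(k <- s) x k ^+ 2.
Proof.
elim: s => [|k s IH]; first by rewrite !big_nil expr0n mul0r.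
rewrite !big_cons /= -nat1r.
have Q0 : 0 <= \sum_(k <- s) x k ^+ 2 by apply: sumr_ge0 => j _; exact: sqr_ge0.
move: IH Q0; move: (\sum_(k <- s) x k) (\sum_(k <- s) x k ^+ 2) (x k) => S Q y IH Q0.
case: (posnP (size s)) IH => [->|m0]; rewrite ?mul0r => IH.
  have -> : S = 0 by apply/eqP; rewrite -sqrf_eq0 eq_le IH sqr_ge0.
  by rewrite !addr0 mul1r lerDl.
have mR : 0 < (size s)%:R :> R by rewrite ltr0n.
set m := (size s)%:R in mR IH *.
(* This absorbs the cross term [2 * y * S]: multiplied by [m], the expression is a square plus the
   defect in the induction hypothesis. *)
have : 0 <= m * (m * y ^+ 2 + Q - 2 * y * S).
  have -> : m * (m * y ^+ 2 + Q - 2 * y * S) = (m * y - S) ^+ 2 + (m * Q - S ^+ 2) by ring.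
  by rewrite addr_ge0 ?sqr_ge0 // subr_ge0.
by rewrite pmulr_rge0 // => h; nra.
Qed.

Lemma sum_nat_sqr_le (R : rcfType) a w (x : nat -> R) :
  (\sum_(a <= k < a + w) x k) ^+ 2 <= w%:R * \sum_(a <= k < a + w) x k ^+ 2.
Proof. by have := sum_sqr_le (index_iota a (a + w)) x; rewrite size_iota addKn. Qed.

Lemma blocksum_ge0 (R : rcfType) (f : nat -> nat -> R) i r j w :
  (forall p q, 0 <= f p q) -> 0 <= blocksum f i r j w.
Proof. by move=> h; apply: sumr_ge0 => p _; apply: sumr_ge0. Qed.

Lemma blocknorm_ge0 (R : rcfType) (f : nat -> nat -> R) i r j w :
  0 <= blocknorm f i r j w.
Proof. exact: sqrtr_ge0. Qed.

Lemma blocknorm_sqr (R : rcfType) (f : nat -> nat -> R) i r j w :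
  blocknorm f i r j w ^+ 2 = blocksum (fun p q => f p q ^+ 2) i r j w.
Proof. by rewrite sqr_sqrtr // blocksum_ge0 // => p q; exact: sqr_ge0. Qed.

Lemma blocknorm_transp (R : rcfType) (f : nat -> nat -> R) i r j w :
  blocknorm (transp f) j w i r = blocknorm f i r j w.
Proof.
by congr Num.sqrt; exact: (blocksum_transp (fun p q => f p q ^+ 2)).
Qed.

Lemma blocksum_abs_le (R : rcfType) (f : nat -> nat -> R) i r j w :
  blocksum (fun p q => `|f p q|) i r j w
  <= Num.sqrt (r%:R * w%:R) * blocknorm f i r j w.
Proof.
have S0 : 0 <= blocksum (fun p q => `|f p q|) i r j w by exact: blocksum_ge0.
rewrite -(ler_pXn2r (_ : (0 < 2)%N)) ?nnegrE ?mulr_ge0 ?sqrtr_ge0 //.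
rewrite exprMn blocknorm_sqr sqr_sqrtr ?mulr_ge0 ?ler0n //.
apply: le_trans (sum_nat_sqr_le _ _ _) _; rewrite -mulrA ler_wpM2l //.
rewrite mulr_sumr; apply: ler_sum => p _; apply: le_trans (sum_nat_sqr_le _ _ _) _.
by rewrite ler_wpM2l //; apply: ler_sum => q _; rewrite real_normK ?num_real.
Qed.

Lemma blocksum_norm_le (R : rcfType) (f : nat -> nat -> R) i r j w :
  `|blocksum f i r j w| <= Num.sqrt (r%:R * w%:R) * blocknorm f i r j w.
Proof.
apply: le_trans _ (blocksum_abs_le f i r j w).
apply: le_trans (ler_norm_sum _ _ _) _; apply: ler_sum => p _; exact: ler_norm_sum.
Qed.

Lemma blocksum_sub (R : rcfType) (f : nat -> nat -> R) i r j w i' r' j' w' :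
  (forall p q, 0 <= f p q) -> (i <= i')%N -> (i' + r' <= i + r)%N ->
  (j <= j')%N -> (j' + w' <= j + w)%N ->
  blocksum f i' r' j' w' <= blocksum f i r j w.
Proof.
move=> f0 h1 h2 h3 h4; apply: (@le_trans _ _ (blocksum f i' r' j w)).
  by apply: ler_sum => p _; apply: sum_nat_subrange.
by apply: sum_nat_subrange => // p; apply: sumr_ge0.
Qed.

Lemma blocknorm_sub (R : rcfType) (f : nat -> nat -> R) i r j w i' r' j' w' :
  (i <= i')%N -> (i' + r' <= i + r)%N ->
  (j <= j')%N -> (j' + w' <= j + w)%N ->
  blocknorm f i' r' j' w' <= blocknorm f i r j w.
Proof.
move=> *; apply: ler_wsqrtr; apply: blocksum_sub => // p q; exact: sqr_ge0.
Qed.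

(** The block is a row of [2 ^ e] tiles as in [blockosc_tile]. On each tile the means contribute [M]
    times the norm of [f], and Cauchy-Schwarz over the tiles costs [sqrt (2 ^ e)]; the oscillations
    add up as the variations do. *)
Lemma blocksum_wide (R : rcfType) n (z f : nat -> nat -> R) M s t e i j :
  0 <= M -> block_bounded n z M ->
  (i + 2 ^ t <= n)%N -> (j + 2 ^ (t + s + e) <= n)%N ->
  `|blocksum (fun p q => z p q * f p q) i (2 ^ t) j (2 ^ (t + s + e))| <=
    M * Num.sqrt (2 ^+ e) * blocknorm f i (2 ^ t) j (2 ^ (t + s + e)) +
    M * (t + s)%:R * (Num.sqrt (2 ^+ s) * blockvar f i (2 ^ t) j (2 ^ (t + s + e))
      + (Num.sqrt (2 ^+ s))^-1 * blockvar (transp f) j (2 ^ (t + s + e)) i (2 ^ t)).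
Proof.
move=> M0 hz hi; elim: e j => [|e IH] j hj.
  rewrite addn0 in hj *.
  have ho := blockosc_tile f M0 hz hi hj.
  set F := blocksum _ _ _ _ _.
  have -> : F = blocksum z i (2 ^ t) j (2 ^ (t + s)) * blocksum f i (2 ^ t) j (2 ^ (t + s))
      / ((2 ^ t)%:R * (2 ^ (t + s))%:R) + blockosc z f i (2 ^ t) j (2 ^ (t + s)).
    by rewrite /blockosc -/F addrC subrK.
  apply: le_trans (ler_normD _ _) _; apply: lerD ho.
  have r0 : 0 < (2 ^ t)%:R * (2 ^ (t + s))%:R :> R by rewrite mulr_gt0 // ltr0n expn_gt0.
  rewrite normrM normfV (gtr0_norm r0) ler_pdivrMr // expr0 sqrtr1 mulr1 normrM.
  apply: le_trans (ler_pM _ _ (hz _ _ _ _ hi hj) (blocksum_norm_le _ _ _ _ _)) _ => //.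
  rewrite -[X in _ <= _ * X](sqr_sqrtr (ltW r0)) le_eqVlt; apply/orP; left.
  by apply/eqP; ring.
have e2 : (2 ^ (t + s + e).+1 = 2 ^ (t + s + e) + 2 ^ (t + s + e))%N.
  by rewrite expnS mul2n addnn.
rewrite addnS e2 in hj *.
rewrite blocksum_catw; apply: le_trans (ler_normD _ _) _.
have q1 := IH j ltac:(lia); have q2 := IH (j + 2 ^ (t + s + e))%N ltac:(lia).
apply: le_trans (lerD q1 q2) _.
have u1 := blockvar_catw f i (2 ^ t) j (2 ^ (t + s + e)) (2 ^ (t + s + e)).
have v1 := blockvar_catr (transp f) j (2 ^ (t + s + e)) (2 ^ (t + s + e)) i (2 ^ t).
have P0 : 0 <= Num.sqrt (2 ^+ s) :> R by exact: sqrtr_ge0.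
rewrite addrACA; apply: lerD; last first.
  rewrite -mulrDr ler_wpM2l ?mulr_ge0 // addrACA -!mulrDr v1 lerD2r.
  by rewrite ler_wpM2l.
rewrite -mulrDr -2!mulrA ler_wpM2l //.
have E : Num.sqrt (2 ^+ e.+1) = Num.sqrt (2 ^+ e) * Num.sqrt 2 :> R.
  by rewrite exprSr sqrtrM // exprn_ge0.
rewrite E -mulrA ler_wpM2l ?sqrtr_ge0 //.
set N1 := blocknorm f i (2 ^ t) j _; set N2 := blocknorm f i (2 ^ t) (j + _) _.
rewrite -(ler_pXn2r (_ : (0 < 2)%N)) ?nnegrE ?mulr_ge0 ?addr_ge0 ?sqrtr_ge0 //.
rewrite exprMn sqr_sqrtr // blocknorm_sqr blocksum_catw -!blocknorm_sqr -/N1 -/N2.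
by have := sqr_ge0 (N1 - N2); nra.
Qed.

(** Tiles of proportions [1 : 2 ^ s], with [s] about [(b - a) / 2], balance the number of tiles, the
    variation along rows and the variation along columns: each contributes a multiple of [P * N]
    with [P = sqrt (2 ^ s)], up to the excesses. Then [P ^ 4 = 2 ^ (s + s) <= 2 ^ b <= n] gives the
    fourth root of [n]. *)
Lemma piece_wide (R : rcfType) n (z f : nat -> nat -> R) M a b i j (N E E' : R) :
  0 <= M -> block_bounded n z M -> (a <= b)%N ->
  (i + 2 ^ a <= n)%N -> (j + 2 ^ b <= n)%N -> 0 <= E -> 0 <= E' ->
  blocknorm f i (2 ^ a) j (2 ^ b) <= N ->
  blockvar f i (2 ^ a) j (2 ^ b) <= 2 * Num.sqrt ((2 ^ a)%:R / (2 ^ b)%:R) * N + E ->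
  blockvar (transp f) j (2 ^ b) i (2 ^ a) <= 2 * Num.sqrt ((2 ^ b)%:R / (2 ^ a)%:R) * N + E' ->
  `|blocksum (fun p q => z p q * f p q) i (2 ^ a) j (2 ^ b)| <=
    M * b.+1%:R * Num.sqrt (Num.sqrt n%:R) * (6 * N + E + E').
Proof.
move=> M0 hz hab hi hj E0 E0' hN hU hW.
have N0 : 0 <= N := le_trans (blocknorm_ge0 _ _ _ _ _) hN.
pose s := ((b - a)./2)%N; pose e := (b - a - s)%N.
(* The parity of [b - a] decides; the case [s.+1] causes the factors 2 in [Pe] and [hba]. *)
have es : (e = s \/ e = s.+1)%N by rewrite /e /s; lia.
have eb : (b = a + s + e)%N by rewrite /e /s; lia.
have hsb : (s + s <= b)%N by rewrite /s; lia.
have := @blocksum_wide _ n z f M s a e i j M0 hz hi; rewrite -eb => /(_ hj).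
set P := Num.sqrt (2 ^+ s).
have P2 : P ^+ 2 = 2 ^+ s by rewrite sqr_sqrtr // exprn_ge0.
have P1 : 1 <= P by rewrite -sqrtr1; apply: ler_wsqrtr; rewrite exprn_ege1 // ler1n.
have P0 : 0 < P by exact: lt_le_trans P1.
have Pn : P <= Num.sqrt (Num.sqrt n%:R).
  rewrite /P; apply: ler_wsqrtr.
  rewrite -[leLHS]ger0_norm ?exprn_ge0 // -sqrtr_sqr; apply: ler_wsqrtr.
  rewrite -exprM muln2 -addnn -natrX ler_nat.
  by apply: leq_trans _ (leq_trans (leq_addl _ _) hj); rewrite leq_exp2l.
have Pe : Num.sqrt (2 ^+ e) <= 2 * P.
  have -> : 2 * P = Num.sqrt (2 ^+ 2 * 2 ^+ s).
    by rewrite sqrtrM ?sqr_ge0 // sqrtr_sqr ger0_norm.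
  apply: ler_wsqrtr; rewrite -exprD.
  by apply: ler_weXn2l; rewrite ?ler1n //; case: es => ->; rewrite ?leq_addl // (leq_add2r s 1 2).
have ba : (2 ^ b)%:R / (2 ^ a)%:R = 2 ^+ s * 2 ^+ e :> R.
  rewrite eb !natrX !exprD; field; rewrite ?gt_eqF ?exprn_gt0 //.
have hba : Num.sqrt ((2 ^ b)%:R / (2 ^ a)%:R) <= 2 * P ^+ 2 :> R.
  by rewrite ba sqrtrM ?exprn_ge0 // expr2 mulrCA ler_wpM2l // ltW.
have hPe : P <= Num.sqrt (2 ^+ e).
  by apply: ler_wsqrtr; case: es => ->; rewrite // exprS ler_peMl ?exprn_ge0 // ler1n.
have hab' : P * Num.sqrt ((2 ^ a)%:R / (2 ^ b)%:R) <= 1 :> R.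
  have -> : (2 ^ a)%:R / (2 ^ b)%:R = (2 ^+ s * 2 ^+ e)^-1 :> R by rewrite -ba invf_div.
  rewrite sqrtrV ?mulr_ge0 ?exprn_ge0 // sqrtrM ?exprn_ge0 // -/P.
  rewrite ler_pdivrMr ?mul1r ?mulr_gt0 ?sqrtr_gt0 ?exprn_gt0 //.
  by rewrite ler_peMr ?(ltW P0) //; exact: le_trans hPe.
set U := blockvar f _ _ _ _ in hU *; set W := blockvar (transp f) _ _ _ _ in hW *.
set K := blocknorm _ _ _ _ _ in hN *.
move=> h; apply: le_trans h _.
have hPU : P * U <= P * (2 * N + E).
  apply: le_trans (ler_wpM2l (ltW P0) hU) _; rewrite !mulrDr lerD2r.
  have hPN : N <= P * N by rewrite ler_peMl.
  by have := ler_wpM2r N0 hab'; lra.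
have hPW : P^-1 * W <= P * (4 * N + E').
  rewrite mulrC ler_pdivrMr //; apply: le_trans hW _.
  have hPE : E' <= P ^+ 2 * E' by rewrite ler_peMl // expr_ge1 // ltW.
  by have := ler_wpM2r N0 hba; lra.
have hk : (a + s)%:R <= b%:R :> R by rewrite ler_nat eb leq_addr.
have h1 : M * Num.sqrt (2 ^+ e) * K <= M * P * (2 * N).
  rewrite -!mulrA ler_wpM2l // [leRHS]mulrA [X in _ <= X * _]mulrC.
  by apply: ler_pM => //; rewrite ?sqrtr_ge0.
have h2 : M * (a + s)%:R * (P * U + P^-1 * W) <= M * b%:R * (P * (6 * N + E + E')).
  have g0 : 0 <= P * U + P^-1 * W.
    by apply: addr_ge0; rewrite mulr_ge0 ?invr_ge0 ?(ltW P0) // blockvar_ge0.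
  have g1 : P * U + P^-1 * W <= P * (6 * N + E + E') by move: hPU hPW; lra.
  exact: (ler_pM (mulr_ge0 M0 (ler0n _ _)) g0 (ler_wpM2l M0 hk) g1).
(* One unit of [b.+1] pays for the block means, the other [b] for the [a + s] levels of halving. *)
apply: (@le_trans _ _ (M * b.+1%:R * P * (6 * N + E + E'))).
  rewrite -[b.+1%:R]nat1r; apply: le_trans (lerD h1 h2) _.
  have : 0 <= M * P * (4 * N + E + E') by rewrite !mulr_ge0 ?addr_ge0 ?mulr_ge0 ?(ltW P0).
  lra.
by rewrite ler_wpM2r ?ler_wpM2l ?addr_ge0 ?mulr_ge0.
Qed.

(** Transposition reduces tall blocks to wide ones. *)
Lemma piece_bound (R : rcfType) n (z f : nat -> nat -> R) M T a b i j (N E E' : R) :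
  0 <= M -> block_bounded n z M -> (a < T)%N -> (b < T)%N ->
  (i + 2 ^ a <= n)%N -> (j + 2 ^ b <= n)%N -> 0 <= E -> 0 <= E' ->
  blocknorm f i (2 ^ a) j (2 ^ b) <= N ->
  blockvar f i (2 ^ a) j (2 ^ b) <= 2 * Num.sqrt ((2 ^ a)%:R / (2 ^ b)%:R) * N + E ->
  blockvar (transp f) j (2 ^ b) i (2 ^ a) <= 2 * Num.sqrt ((2 ^ b)%:R / (2 ^ a)%:R) * N + E' ->
  `|blocksum (fun p q => z p q * f p q) i (2 ^ a) j (2 ^ b)| <=
    M * T%:R * Num.sqrt (Num.sqrt n%:R) * (6 * N + E + E').
Proof.
move=> M0 hz ha hb hi hj E0 E0' hN hU hW.
have N0 : 0 <= N := le_trans (blocknorm_ge0 _ _ _ _ _) hN.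
have hm c : (c < T)%N -> M * c.+1%:R * Num.sqrt (Num.sqrt n%:R) * (6 * N + E + E') <=
    M * T%:R * Num.sqrt (Num.sqrt n%:R) * (6 * N + E + E').
  move=> hc; rewrite ler_wpM2r ?addr_ge0 ?mulr_ge0 // ler_wpM2r ?sqrtr_ge0 //.
  by rewrite ler_wpM2l // ler_nat.
have [hab|/ltnW hba] := leqP a b.
  exact: le_trans (piece_wide M0 hz hab hi hj E0 E0' hN hU hW) (hm _ hb).
rewrite -(blocksum_transp (fun p q => z p q * f p q)).
rewrite -(blocknorm_transp f) in hN.
apply: le_trans _ (hm _ ha); rewrite -addrA (addrC E) addrA.
exact: (piece_wide (f := transp f) M0 (block_bounded_transp hz) hba hj hi E0' E0 hN hW hU).
Qed.

(** * Whitney decomposition of a rectangle *)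

(** The pairs are a starting point and an exponent. A partition is encoded by its effect on sums, so
    covering and disjointness never have to be treated separately. *)
Definition tiling (R : rcfType) (lo len : nat) (l : seq (nat * nat)) : Prop :=
  forall g : nat -> R, \sum_(lo <= k < lo + len) g k =
    \sum_(x <- l) \sum_(x.1 <= k < x.1 + 2 ^ x.2) g k.

(** The binary expansion of [len], largest power first. *)
Lemma binary_tiling (R : rcfType) A lo len : (len < 2 ^ A)%N ->
  exists l, [/\ tiling R lo len l, (size l <= A)%N &
    forall x, x \in l -> [/\ x.2 < A, lo <= x.1 & x.1 + 2 ^ x.2 <= lo + len]%N].
Proof.
elim: A lo len => [|A IH] lo len hl.
  exists [::]; split=> // g; rewrite big_nil big_geq //.
  by move: hl; rewrite expn0; lia.
have [h|h] := ltnP len (2 ^ A).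
  have [l [h1 h2 h3]] := IH lo len h; exists l; split=> //; first by lia.
  by move=> x /h3[? ? ?]; split=> //; lia.
have [|l [h1 h2 h3]] := IH (lo + 2 ^ A)%N (len - 2 ^ A)%N.
  by move: hl; rewrite expnS; lia.
exists ((lo, A) :: l); split=> [g||x].
- rewrite big_cons /= (@sum_nat_split _ g lo (lo + 2 ^ A)); last by lia.
  by rewrite -h1; congr (_ + \sum_(_ <= _ < _) _); lia.
- by rewrite /=; lia.
- rewrite inE => /orP[/eqP->/=|/h3[? ? ?]]; split=> //; lia.
Qed.

(** Peel a tile of length [2 ^ A] off each end, then one of length [2 ^ A.+1] off each end of the
    rest, and so on; once the rest is shorter than two tiles, [binary_tiling] finishes. The length
    peeled off makes up for the doubled slack [2 ^ A.+1] in the induction hypothesis. *)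
Lemma whitney_tiling_aux (R : rcfType) T d A lo len :
  (A + d = T)%N -> (len < 2 ^ T)%N ->
  exists l, [/\ tiling R lo len l, (size l <= 2 * d + T.+1)%N &
    forall x, x \in l -> [/\ lo <= x.1, x.1 + 2 ^ x.2 <= lo + len,
      lo + 2 ^ x.2 <= x.1 + 2 ^ A &
      x.1 + 2 ^ x.2 + 2 ^ x.2 <= lo + len + 2 ^ A]%N].
Proof.
elim: d A lo len => [|d IH] A lo len hA hl.
  have hl' : (len < 2 ^ A.+1)%N by move: hl; rewrite expnS -hA addn0; lia.
  have [l [h1 h2 h3]] := binary_tiling R lo hl'; exists l; split=> //; first by lia.
  move=> x /h3[x1 x2 x3].
  by have : (2 ^ x.2 <= 2 ^ A)%N; [rewrite leq_exp2l | split => //; lia].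
have [hl'|hl'] := ltnP len (2 ^ A.+1).
  have [l [h1 h2 h3]] := binary_tiling R lo hl'; exists l; split=> //; first by lia.
  move=> x /h3[x1 x2 x3].
  by have : (2 ^ x.2 <= 2 ^ A)%N; [rewrite leq_exp2l | split => //; lia].
have e2 : (2 ^ A.+1 = 2 ^ A + 2 ^ A)%N by rewrite expnS mul2n addnn.
have [||l [h1 h2 h3]] := IH A.+1 (lo + 2 ^ A)%N (len - 2 ^ A.+1)%N; [by lia|by lia|].
exists [:: (lo, A), ((lo + len - 2 ^ A)%N, A) & l]; split=> [g||x].
- rewrite !big_cons /= (@sum_nat_split _ g lo (lo + 2 ^ A)); last by lia.
  rewrite (@sum_nat_split _ g (lo + 2 ^ A) (lo + len - 2 ^ A)); last by lia.
  rewrite subnK; last by lia.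
  rewrite [X in _ + X]addrC -h1; congr (_ + (_ + \sum_(_ <= _ < _) _)); lia.
- by rewrite /=; lia.
- rewrite !inE => /orP[/eqP->/=|/orP[/eqP->/=|/h3[x1 x2 x3 x4]]]; split; lia.
Qed.

(* Each tile is at least as far from the ends of the interval as it is long. *)
Lemma whitney_tiling (R : rcfType) T lo len : (len < 2 ^ T)%N ->
  exists l, [/\ tiling R lo len l, (size l <= 3 * T + 1)%N &
    forall x, x \in l -> [/\ x.2 < T, lo + 2 ^ x.2 <= x.1.+1 &
      x.1 + 2 ^ x.2 + 2 ^ x.2 <= (lo + len).+1]%N].
Proof.
move=> hl; have [l [h1 h2 h3]] := @whitney_tiling_aux R T T 0 lo len (add0n T) hl.
exists l; split=> //; first by lia.
move=> x /h3[]; rewrite expn0 => x1 x2 x3 x4; split; [|lia|lia].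
rewrite -(@ltn_exp2l 2) //; lia.
Qed.

(** * Light rows and columns, and the excess of variation *)

Lemma exists_le_avg (R : rcfType) (g : nat -> R) a w : (0 < w)%N ->
  exists2 x, (a <= x < a + w)%N & w%:R * g x <= \sum_(a <= k < a + w) g k.
Proof.
move=> w0; set S := \sum_(a <= k < a + w) g k.
have [/hasP[x]|/hasPn h] := boolP (has (fun x => w%:R * g x <= S) (index_iota a (a + w))).
  by rewrite mem_index_iota => hx hS; exists x.
have : \sum_(a <= k < a + w) S < \sum_(a <= k < a + w) w%:R * g k.
  apply: ltr_sum_nat; first by lia.
  by move=> k hk; rewrite ltNge; apply: h; rewrite mem_index_iota.
by rewrite sumr_const_nat addKn -mulr_sumr -/S mulr_natl ltxx.
Qed.

(* The variation needed to go from both end values down to the value at m is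
   at least |u j| + |u (j + w - 1)| - 2 |u m|; the excess is what exceeds this. *)
Definition rowexcess (R : rcfType) (u : nat -> R) (j w m : nat) : R :=
  var u j w - `|u j| - `|u (j + w).-1| + 2 * `|u m|.

Definition blockexcess (R : rcfType) (f : nat -> nat -> R) (i r j w m : nat) : R :=
  \sum_(i <= p < i + r) rowexcess (f p) j w m.

(** The variation outside [[x, y]] is at least what leads from the end values to [|u x|] and
    [|u y|]. Subtracting it from the total leaves the bound; of the term [2 * |u m|] only the sign
    matters. *)
Lemma rowexcess_sub (R : rcfType) (u : nat -> R) j w m x y s v :
  (0 < v)%N -> (j <= x <= s)%N -> ((s + v).-1 <= y)%N -> (y < j + w)%N ->
  var u s v <= `|u x| + `|u y| + rowexcess u j w m.
Proof.
move=> v0 /andP[jx xs] sy yj.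
have h : `|u x - u j| + var u s v + `|u (j + w).-1 - u y| <= var u j w.
  rewrite {2}/var (@sum_nat_split _ _ j x); last by lia.
  rewrite (@sum_nat_split _ _ x y); last by lia.
  rewrite addrA; apply: lerD; last first.
    have -> : (j + w.-1 = (j + w).-1)%N by lia.
    by apply: dist_le_sum; lia.
  apply: lerD; first exact: dist_le_sum.
  by apply: sum_nat_subrange => //; lia.
have h1 := lerB_dist (u j) (u x); have h2 := lerB_dist (u (j + w).-1) (u y).
rewrite distrC in h1.
by have := normr_ge0 (u m); rewrite /rowexcess; lra.
Qed.

Lemma rowexcess_ge0 (R : rcfType) (u : nat -> R) j w m :
  (j <= m < j + w)%N -> 0 <= rowexcess u j w m.
Proof.
case/andP=> jm mj.
have h : `|u m - u j| + `|u (j + w).-1 - u m| <= var u j w.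
  rewrite /var (@sum_nat_split _ _ j m); last by lia.
  have -> : (j + w.-1 = (j + w).-1)%N by lia.
  by apply: lerD; apply: dist_le_sum; lia.
have h1 := lerB_dist (u j) (u m); have h2 := lerB_dist (u (j + w).-1) (u m).
rewrite distrC in h1.
by rewrite /rowexcess; lra.
Qed.

Lemma blockexcess_ge0 (R : rcfType) (f : nat -> nat -> R) i r j w m :
  (j <= m < j + w)%N -> 0 <= blockexcess f i r j w m.
Proof. by move=> h; apply: sumr_ge0 => p _; exact: rowexcess_ge0. Qed.

(** The best column is no worse than the average one, whose l1 norm is bounded by Cauchy-Schwarz on
    the block. *)
Lemma light_column (R : rcfType) (f : nat -> nat -> R) i r j w : (0 < w)%N ->
  exists2 x, (j <= x < j + w)%N &
    \sum_(i <= p < i + r) `|f p x| <= Num.sqrt (r%:R / w%:R) * blocknorm f i r j w.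
Proof.
move=> w0; have [x hx h] := exists_le_avg (fun q => \sum_(i <= p < i + r) `|f p q|) j w0.
exists x => //; have wR : 0 < w%:R :> R by rewrite ltr0n.
rewrite -(ler_pM2l wR); apply: le_trans h _.
rewrite exchange_big_nat; apply: le_trans (blocksum_abs_le f i r j w) _.
rewrite mulrA ler_wpM2r ?blocknorm_ge0 //.
rewrite -[X in _ <= X * _]ger0_norm ?(ltW wR) // -sqrtr_sqr -sqrtrM ?sqr_ge0 //.
by rewrite le_eqVlt; apply/orP; left; apply/eqP; congr Num.sqrt; field; rewrite gt_eqF.
Qed.

(** There is room for [v] columns on either side of the tile. A light column among them on the left
    and one on the right bound the l1 terms of [rowexcess_sub], hence the factor 2. *)
Lemma blockvar_interior (R : rcfType) (f : nat -> nat -> R) i r j w m i' r' s v :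
  (0 < v)%N -> (j <= m < j + w)%N -> (i <= i')%N -> (i' + r' <= i + r)%N ->
  (j + v <= s.+1)%N -> (s + v + v <= (j + w).+1)%N ->
  blockvar f i' r' s v <=
    2 * Num.sqrt (r'%:R / v%:R) * blocknorm f i r j w + blockexcess f i r j w m.
Proof.
move=> v0 hm h1 h2 h3 h4.
(* Each window of width [v] shares one extreme column with the tile; this is the off-by-one in the
   hypotheses on [s] and in [whitney_tiling]. *)
have [x hx hX] := light_column f i' r' (s.+1 - v) v0.
have [y hy hY] := light_column f i' r' (s + v).-1 v0.
have hnx : blocknorm f i' r' (s.+1 - v) v <= blocknorm f i r j w.
  by apply: blocknorm_sub; lia.
have hny : blocknorm f i' r' (s + v).-1 v <= blocknorm f i r j w.
  by apply: blocknorm_sub; lia.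
apply: (@le_trans _ _ (\sum_(i' <= p < i' + r') `|f p x| + \sum_(i' <= p < i' + r') `|f p y|
   + \sum_(i' <= p < i' + r') rowexcess (f p) j w m)).
  rewrite -!big_split /=; apply: ler_sum => p _; apply: rowexcess_sub => //; lia.
have hq : 0 <= Num.sqrt (r'%:R / v%:R) :> R by exact: sqrtr_ge0.
apply: lerD; last first.
  by apply: sum_nat_subrange => // p; exact: rowexcess_ge0.
have := ler_wpM2l hq hnx; have := ler_wpM2l hq hny; lra.
Qed.

Lemma blocksum_tiling (R : rcfType) (f : nat -> nat -> R) i r j w lr lw :
  tiling R i r lr -> tiling R j w lw ->
  blocksum f i r j w = \sum_(x <- lr) \sum_(y <- lw)
    blocksum f x.1 (2 ^ x.2) y.1 (2 ^ y.2).
Proof.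
move=> hr hw; rewrite /blocksum hr; apply: eq_bigr => x _.
rewrite [RHS]exchange_big /=; apply: eq_bigr => p _; exact: hw.
Qed.

(** Cutting both sides by [whitney_tiling] gives at most [(3 * T + 1) ^ 2] tiles. Each is bounded
    through the norm and the excesses of the whole rectangle, a loss of logarithms only. *)
Lemma rect_bound (R : rcfType) n T (z f : nat -> nat -> R) M i r j w mi mj :
  0 <= M -> block_bounded n z M -> (n < 2 ^ T)%N ->
  (i + r <= n)%N -> (j + w <= n)%N -> (i <= mi < i + r)%N -> (j <= mj < j + w)%N ->
  `|blocksum (fun p q => z p q * f p q) i r j w| <=
    (3 * T + 1)%:R ^+ 2 * (M * T%:R * Num.sqrt (Num.sqrt n%:R) *
    (6 * blocknorm f i r j w + blockexcess f i r j w mj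
      + blockexcess (transp f) j w i r mi)).
Proof.
move=> M0 hz hT hi hj hmi hmj.
have [|lr [r1 r2 r3]] := @whitney_tiling R T i r; first by lia.
have [|lw [w1 w2 w3]] := @whitney_tiling R T j w; first by lia.
rewrite (blocksum_tiling _ r1 w1).
set B := M * _ * _ * _.
have E0 := blockexcess_ge0 f i r hmj; have E0' := blockexcess_ge0 (transp f) j w hmi.
have B0 : 0 <= B.
  by rewrite /B !mulr_ge0 ?sqrtr_ge0 ?addr_ge0 ?mulr_ge0 ?blocknorm_ge0.
have hp x y : x \in lr -> y \in lw ->
    `|blocksum (fun p q => z p q * f p q) x.1 (2 ^ x.2) y.1 (2 ^ y.2)| <= B.
  move=> /r3[x1 x2 x3] /w3[y1 y2 y3].
  have vx : (0 < 2 ^ x.2)%N by rewrite expn_gt0.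
  have vy : (0 < 2 ^ y.2)%N by rewrite expn_gt0.
  apply: piece_bound => //; [lia|lia|apply: blocknorm_sub; lia| |].
    by apply: blockvar_interior; lia.
  by rewrite -(blocknorm_transp f); apply: blockvar_interior; lia.
apply: le_trans (ler_norm_sum _ _ _) _.
apply: (@le_trans _ _ (\sum_(x <- lr) \sum_(y <- lw) B)).
  rewrite big_seq [leRHS]big_seq; apply: ler_sum => x hx.
  apply: le_trans (ler_norm_sum _ _ _) _.
  by rewrite big_seq [leRHS]big_seq; apply: ler_sum => y hy; exact: hp.
rewrite !big_const_seq !count_predT !iter_addr_0 -mulrnA -[B *+ _]mulr_natl ler_wpM2r //.
by rewrite natrM expr2 ler_pM // ler_nat.
Qed.

(** * Summation over the partition *)

(* [a l, b l] x [c l, d l] (bounds included) is the rectangle of label l. *)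
Definition rect_labels (n k : nat) (L : nat -> nat -> 'I_k) (a b c d : 'I_k -> nat) :=
  (forall l, [/\ a l <= b l, b l <= n, c l <= d l & d l <= n]%N) /\
  (forall l i j, (i <= n)%N -> (j <= n)%N ->
    (L i j == l) = ((a l <= i <= b l) && (c l <= j <= d l))%N).

Lemma rect_labels_transp n k (L : nat -> nat -> 'I_k) a b c d :
  rect_labels n L a b c d -> rect_labels n (fun i j => L j i) c d a b.
Proof.
move=> [h1 h2]; split=> [l|l i j hi hj]; first by case: (h1 l).
by rewrite h2 // andbC.
Qed.

Lemma sum_if_range (R : rcfType) (F : nat -> R) n a b : (a <= b)%N -> (b <= n)%N ->
  \sum_(0 <= i < n.+1) (if (a <= i <= b)%N then F i else 0) =
  \sum_(a <= i < a + (b - a).+1) F i.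
Proof.
move=> hab hbn; have -> : (a + (b - a).+1 = b.+1)%N by lia.
rewrite (@sum_nat_split _ _ 0 a n.+1); last by lia.
rewrite (@sum_nat_split _ _ a b.+1 n.+1); last by lia.
rewrite [X in X + _]big1_seq ?add0r; last first.
  by move=> i; rewrite mem_index_iota /= => h; case: ifP => //; lia.
rewrite [X in _ + X]big1_seq ?addr0; last first.
  by move=> i; rewrite mem_index_iota /= => h; case: ifP => //; lia.
by apply: eq_big_nat => i h; case: ifP => //; lia.
Qed.

Lemma sum_label (R : rcfType) k (l : 'I_k) (x : R) :
  \sum_(i < k) (if l == i then x else 0) = x.
Proof.
by rewrite (bigD1 l) //= eqxx big1 ?addr0 // => i; rewrite eq_sym => /negbTE ->.
Qed.

Lemma sum_rect_labels (R : rcfType) n k (L : nat -> nat -> 'I_k) a b c d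
    (g : nat -> nat -> R) :
  rect_labels n L a b c d ->
  \sum_(0 <= i < n.+1) \sum_(0 <= j < n.+1) g i j =
  \sum_(l < k) blocksum g (a l) (b l - a l).+1 (c l) (d l - c l).+1.
Proof.
move=> [h1 h2].
transitivity (\sum_(l < k) \sum_(0 <= i < n.+1) \sum_(0 <= j < n.+1)
    (if L i j == l then g i j else 0)).
  rewrite [RHS]exchange_big /=; apply: eq_bigr => i _; rewrite [RHS]exchange_big /=.
  by apply: eq_bigr => j _; rewrite sum_label.
apply: eq_bigr => l _; have [hab hb hcd hd] := h1 l.
rewrite /blocksum -(@sum_if_range _ _ n) //; apply: eq_big_nat => i hi.
transitivity (\sum_(0 <= j < n.+1) (if (a l <= i <= b l)%N then
   (if (c l <= j <= d l)%N then g i j else 0) else 0)).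
  apply: eq_big_nat => j hj; rewrite h2; [|lia|lia].
  by case: (_ <= _ <= _)%N.
case: ifP => _; last by rewrite big1.
by rewrite sum_if_range.
Qed.

(** What a grid edge contributes to one rectangle: [p] and [q] tell whether its endpoints lie
    inside. An edge that leaves the rectangle is charged minus the absolute value at its inner
    endpoint. *)
Definition signed_step (R : rcfType) (p q : bool) (x y : R) : R :=
  if p then (if q then `|y - x| else - `|x|) else (if q then - `|y| else 0).

(** Inner edges add up to the variation, the two leaving edges to [- |u c| - |u d|]. At the border
    of the grid the leaving edge does not exist and contributes zero, hence an inequality. *)
Lemma signed_step_row (R : rcfType) (u : nat -> R) n c d : (c <= d)%N -> (d <= n)%N ->
  var u c (d - c).+1 - `|u c| - `|u d| <=
  \sum_(0 <= j < n) signed_step (c <= j <= d)%N (c <= j.+1 <= d)%N (u j) (u j.+1).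
Proof.
move=> hcd hdn.
have hA : - `|u c| <= \sum_(0 <= j < c)
    signed_step (c <= j <= d)%N (c <= j.+1 <= d)%N (u j) (u j.+1).
  case: c hcd => [|c] hcd; first by rewrite big_geq // oppr_le0.
  rewrite big_nat_recr //= big1_seq ?add0r; last first.
    move=> j; rewrite mem_index_iota /= => hj; rewrite /signed_step.
    by case: ifP; [lia|]; case: ifP => //; lia.
  by rewrite /signed_step ltnn /= leqnn hcd.
rewrite (@sum_nat_split _ _ 0 c n); last by lia.
rewrite (@sum_nat_split _ _ c d n); last by lia.
set A := \sum_(0 <= j < c) _ in hA *; set B := \sum_(c <= j < d) _.
set C := \sum_(d <= j < n) _.
have hC : - `|u d| <= C.
  rewrite /C; have [hd|hd] := leqP n d; first by rewrite big_geq // oppr_le0.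
  rewrite big_ltn //= big1_seq ?addr0; last first.
    move=> j; rewrite mem_index_iota /= => hj; rewrite /signed_step.
    by case: ifP; [lia|]; case: ifP => //; lia.
  by rewrite /signed_step hcd leqnn ltnn andbF.
have -> : var u c (d - c).+1 = B.
  rewrite /var /= subnKC // /B; apply: eq_big_nat => j hj; rewrite /signed_step.
  by case: ifP; [|lia]; case: ifP => //; lia.
by move: hA hC; lra.
Qed.

(** An edge between two rectangles is charged once by each, in total [- |x| - |y| <= - |y - x|]. *)
Lemma signed_step_label (R : rcfType) k (l l' : 'I_k) (x y : R) :
  \sum_(i < k) signed_step (l == i) (l' == i) x y <=
  if l == l' then `|y - x| else - `|y - x|.
Proof.
case: eqP => [<-|/eqP ne].
  rewrite -[leRHS](sum_label l); apply: ler_sum => i _.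
  by rewrite /signed_step; case: (l == i).
apply: (@le_trans _ _ (- `|x| - `|y|)).
  rewrite -(sum_label l (- `|x|)) -(sum_label l' (- `|y|)) -big_split /=.
  apply: ler_sum => i _; rewrite /signed_step.
  case: (l =P i) => [<-|_]; first by rewrite eq_sym (negbTE ne) addr0.
  by rewrite add0r.
by have := ler_normB y x; lra.
Qed.

(** The subtracted sum cancels the [2 * |u m|] of the excess: whatever [m] is, the left-hand side is
    the variation along rows inside the rectangles minus the l1 norm of [f] on their vertical
    sides. *)
Lemma signed_rows (R : rcfType) n k (L : nat -> nat -> 'I_k) a b c d
    (f : nat -> nat -> R) (m : 'I_k -> nat) :
  rect_labels n L a b c d ->
  \sum_(l < k) (blockexcess f (a l) (b l - a l).+1 (c l) (d l - c l).+1 (m l)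
     - 2 * \sum_(a l <= p < a l + (b l - a l).+1) `|f p (m l)|) <=
  \sum_(0 <= i < n.+1) \sum_(0 <= j < n)
    (if L i j == L i j.+1 then `|f i j.+1 - f i j| else - `|f i j.+1 - f i j|).
Proof.
move=> [h1 h2].
apply: (@le_trans _ _ (\sum_(0 <= i < n.+1) \sum_(0 <= j < n) \sum_(l < k)
    signed_step (L i j == l) (L i j.+1 == l) (f i j) (f i j.+1))); last first.
  by apply: ler_sum => i _; apply: ler_sum => j _; exact: signed_step_label.
under [leRHS]eq_bigr do rewrite exchange_big /=.
rewrite [leRHS]exchange_big /=; apply: ler_sum => l _; have [hab hb hcd hd] := h1 l.
rewrite /blockexcess mulr_sumr -sumrB -(@sum_if_range _ _ n) //.
apply: ler_sum_nat => i hi.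
case: ifP => hi'; last first.
  rewrite big1_seq // => j; rewrite mem_index_iota /= => hj.
  by rewrite !h2 ?hi' //; lia.
rewrite /rowexcess addrK; have -> : (c l + (d l - c l).+1).-1 = d l by lia.
apply: le_trans (signed_step_row _ hcd hd) _.
rewrite le_eqVlt; apply/orP; left; apply/eqP; apply: eq_big_nat => j hj.
by rewrite !h2 ?hi' //; lia.
Qed.

(** By [signed_rows] in both directions, the last hypothesis bounds the excesses by twice the l1
    norms of the lines [mi] and [mj]. Light lines are chosen; the aspect ratio bounds each by
    [sqrt A] times the block norm. *)
Lemma excess_sum_le (R : rcfType) n k (L : nat -> nat -> 'I_k) a b c d
    (f : nat -> nat -> R) (A : R) :
  rect_labels n L a b c d -> 0 <= A ->
  (forall l, (b l - a l).+1%:R <= A * (d l - c l).+1%:R) ->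
  (forall l, (d l - c l).+1%:R <= A * (b l - a l).+1%:R) ->
  \sum_(0 <= i < n.+1) \sum_(0 <= j < n)
    (if L i j == L i j.+1 then `|f i j.+1 - f i j| else - `|f i j.+1 - f i j|) +
  \sum_(0 <= j < n.+1) \sum_(0 <= i < n)
    (if L i j == L i.+1 j then `|f i.+1 j - f i j| else - `|f i.+1 j - f i j|) <= 0 ->
  exists mi mj : 'I_k -> nat,
    [/\ forall l, (a l <= mi l < a l + (b l - a l).+1)%N,
        forall l, (c l <= mj l < c l + (d l - c l).+1)%N &
     \sum_(l < k) (blockexcess f (a l) (b l - a l).+1 (c l) (d l - c l).+1 (mj l)
       + blockexcess (transp f) (c l) (d l - c l).+1 (a l) (b l - a l).+1 (mi l))
     <= 4 * Num.sqrt A *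
       \sum_(l < k) blocknorm f (a l) (b l - a l).+1 (c l) (d l - c l).+1].
Proof.
move=> hL A0 hA1 hA2 hTV.
have sq (p q : nat) : (0 < q)%N -> p%:R <= A * q%:R -> Num.sqrt (p%:R / q%:R) <= Num.sqrt A.
  by move=> q0 h; apply: ler_wsqrtr; rewrite ler_pdivrMr // ltr0n.
have colP l : exists x, ((c l <= x < c l + (d l - c l).+1)%N &&
   (\sum_(a l <= p < a l + (b l - a l).+1) `|f p x| <=
   Num.sqrt A * blocknorm f (a l) (b l - a l).+1 (c l) (d l - c l).+1)).
  have [x hx h] := light_column f (a l) (b l - a l).+1 (c l) (ltn0Sn (d l - c l)).
  exists x; rewrite hx /=; apply: le_trans h _.
  by rewrite ler_wpM2r ?blocknorm_ge0 // sq.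
have rowP l : exists x, ((a l <= x < a l + (b l - a l).+1)%N &&
   (\sum_(c l <= p < c l + (d l - c l).+1) `|transp f p x| <=
   Num.sqrt A * blocknorm f (a l) (b l - a l).+1 (c l) (d l - c l).+1)).
  have [x hx h] := light_column (transp f) (c l) (d l - c l).+1 (a l) (ltn0Sn (b l - a l)).
  exists x; rewrite hx /=; apply: le_trans h _.
  by rewrite blocknorm_transp ler_wpM2r ?blocknorm_ge0 // sq.
pose mj l := xchoose (colP l); pose mi l := xchoose (rowP l).
exists mi, mj; split=> [l|l|]; try by case/andP: (xchooseP (rowP l)).
  by case/andP: (xchooseP (colP l)).
have s1 := signed_rows f mj hL.
have s2 := signed_rows (transp f) mi (rect_labels_transp hL).
have := le_trans (lerD s1 s2) hTV; rewrite !sumrB -!mulr_sumr big_split /=.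
have c1 : \sum_(l < k) \sum_(a l <= p < a l + (b l - a l).+1) `|f p (mj l)| <=
    Num.sqrt A * \sum_(l < k) blocknorm f (a l) (b l - a l).+1 (c l) (d l - c l).+1.
  by rewrite mulr_sumr; apply: ler_sum => l _; case/andP: (xchooseP (colP l)).
have c2 : \sum_(l < k) \sum_(c l <= p < c l + (d l - c l).+1) `|transp f p (mi l)| <=
    Num.sqrt A * \sum_(l < k) blocknorm f (a l) (b l - a l).+1 (c l) (d l - c l).+1.
  by rewrite mulr_sumr; apply: ler_sum => l _; case/andP: (xchooseP (rowP l)).
by move: c1 c2; lra.
Qed.

(** Sum [rect_bound] over the rectangles; by Cauchy-Schwarz the [k] block norms add up to at most
    [sqrt k] times the norm of [f]. *)
Lemma inner_product_bound (R : rcfType) n k T (L : nat -> nat -> 'I_k) a b c d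
    (z f : nat -> nat -> R) (M A : R) :
  0 <= M -> block_bounded n.+1 z M -> (n.+1 < 2 ^ T)%N ->
  rect_labels n L a b c d -> 0 <= A ->
  (forall l, (b l - a l).+1%:R <= A * (d l - c l).+1%:R) ->
  (forall l, (d l - c l).+1%:R <= A * (b l - a l).+1%:R) ->
  \sum_(0 <= i < n.+1) \sum_(0 <= j < n)
    (if L i j == L i j.+1 then `|f i j.+1 - f i j| else - `|f i j.+1 - f i j|) +
  \sum_(0 <= j < n.+1) \sum_(0 <= i < n)
    (if L i j == L i.+1 j then `|f i.+1 j - f i j| else - `|f i.+1 j - f i j|) <= 0 ->
  `|\sum_(0 <= i < n.+1) \sum_(0 <= j < n.+1) z i j * f i j| <=
  (3 * T + 1)%:R ^+ 2 * T%:R * (6 + 4 * Num.sqrt A) * Num.sqrt (Num.sqrt n.+1%:R) *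
  Num.sqrt k%:R * M *
  Num.sqrt (\sum_(0 <= i < n.+1) \sum_(0 <= j < n.+1) f i j ^+ 2).
Proof.
move=> M0 hz hT hL A0 hA1 hA2 hTV.
have [mi [mj [hmi hmj hE]]] := excess_sum_le hL A0 hA1 hA2 hTV.
rewrite (sum_rect_labels _ hL) (sum_rect_labels (fun i j => f i j ^+ 2) hL).
set S := \sum_(l < k) blocknorm _ _ _ _ _ in hE.
have hS : S <= Num.sqrt k%:R * Num.sqrt (\sum_(l < k)
    blocksum (fun i j => f i j ^+ 2) (a l) (b l - a l).+1 (c l) (d l - c l).+1).
  rewrite -sqrtrM ?ler0n // -[leLHS]ger0_norm; last first.
    by apply: sumr_ge0 => l _; exact: blocknorm_ge0.
  rewrite -sqrtr_sqr; apply: ler_wsqrtr.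
  apply: le_trans (sum_sqr_le (index_enum 'I_k) _) _.
  have -> : size (index_enum 'I_k) = k by rewrite -[in RHS](card_ord k) cardT enumT.
  by under eq_bigr do rewrite blocknorm_sqr.
set Q := Num.sqrt (\sum_(l < k) _) in hS *.
set W := Num.sqrt (Num.sqrt _).
apply: le_trans (ler_norm_sum _ _ _) _.
apply: (@le_trans _ _ (\sum_(l < k) (3 * T + 1)%:R ^+ 2 * (M * T%:R * W *
    (6 * blocknorm f (a l) (b l - a l).+1 (c l) (d l - c l).+1
     + (blockexcess f (a l) (b l - a l).+1 (c l) (d l - c l).+1 (mj l)
       + blockexcess (transp f) (c l) (d l - c l).+1 (a l) (b l - a l).+1 (mi l)))))).
  apply: ler_sum => l _; have [hab hb hcd hd] := hL.1 l; rewrite [X in _ * (_ * X)]addrA.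
  by apply: rect_bound => //; lia.
rewrite -!mulr_sumr big_split /= -mulr_sumr -/S.
have K0 : 0 <= (3 * T + 1)%:R ^+ 2 * (M * T%:R * W) :> R by rewrite !mulr_ge0 ?sqr_ge0 ?sqrtr_ge0.
have h : 6 * S + \sum_(l < k) (blockexcess f (a l) (b l - a l).+1 (c l) (d l - c l).+1 (mj l)
       + blockexcess (transp f) (c l) (d l - c l).+1 (a l) (b l - a l).+1 (mi l))
    <= (6 + 4 * Num.sqrt A) * (Num.sqrt k%:R * Q).
  apply: le_trans (lerD (lexx _) hE) _; rewrite -mulrDl; apply: ler_wpM2l hS.
  by apply: addr_ge0 => //; rewrite mulr_ge0 // sqrtr_ge0.
rewrite mulrA; apply: le_trans (ler_wpM2l K0 h) _.
by rewrite le_eqVlt; apply/orP; left; apply/eqP; ring.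
Qed.

(** * Errors of the estimator *)

(** Passage from natural-number indices to ordinals; out of range, [inord] returns [ord0]. *)
Definition icell (n i j : nat) : cell n.+1 := (inord i, inord j).

Lemma sum_ord_nat (R : realType) n (F : 'I_n.+1 -> R) :
  \sum_(i < n.+1) F i = \sum_(0 <= i < n.+1) F (inord i).
Proof. by rewrite big_mkord; apply: eq_bigr => i _; rewrite inord_val. Qed.

Lemma sum_cell_nat (R : realType) n (F : cell n.+1 -> R) :
  \sum_u F u = \sum_(0 <= i < n.+1) \sum_(0 <= j < n.+1) F (icell n i j).
Proof.
transitivity (\sum_i \sum_j F (i, j)).
  by rewrite pair_bigA; apply: eq_bigr => -[].
by rewrite sum_ord_nat; apply: eq_bigr => i _; rewrite sum_ord_nat.
Qed.

Lemma sum_edges_from (R : realType) n (G : cell n.+1 -> R) i j :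
  (i < n.+1)%N -> (j < n.+1)%N ->
  \sum_(v | grid_edge (icell n i j) v) G v =
  (if (j < n)%N then G (icell n i j.+1) else 0) +
  (if (i < n)%N then G (icell n i.+1 j) else 0).
Proof.
move=> hi hj.
have pick (p : cell n.+1) (t : bool) : \sum_v (if (v == p) && t then G v else 0) =
    if t then G p else 0.
  rewrite -big_mkcond; case: t; last by rewrite big_pred0 // => v; rewrite andbF.
  by rewrite (big_pred1 p) // => v; rewrite andbT.
rewrite -!pick -big_split big_mkcond /=; apply: eq_bigr => -[p q] _.
rewrite /grid_edge /icell /= !xpair_eqE -!val_eqE /= (inordK hi) (inordK hj).
have hp := ltn_ord p; have hq := ltn_ord q; move: (G (p, q)) => g.
move: (nat_of_ord p) (nat_of_ord q) hp hq => p' q' hp hq; rewrite !(eq_sym _ p') !(eq_sym _ q').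
rewrite (andbC (q' == j)).
(* The two kinds of neighbours exclude each other, and the existence of one forces the index below
   [n]; this settles the last row and column. *)
have hA : (p' == i) && (q' == j.+1) ==> ~~ ((p' == i.+1) && (q' == j)) by lia.
have hAj : (p' == i) && (q' == j.+1) ==> (j < n)%N by lia.
have hBi : (p' == i.+1) && (q' == j) ==> (i < n)%N by lia.
have [hjn|hjn] := ltnP j n; have [hin|hin] := ltnP i n;
  rewrite ?(ltnNge j n) ?(ltnNge i n) ?hjn ?hin /= ?implybF in hAj hBi;
  rewrite ?andbF ?andbT ?(@inordK n j.+1) ?(@inordK n i.+1) //;
  rewrite ?(negbTE hAj) ?(negbTE hBi) ?addr0 ?add0r ?orbF //.
by case: (_ && _) hA; case: (_ && _) => //; rewrite ?addr0 ?add0r.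
Qed.

Lemma sum_edges (R : realType) n (G : cell n.+1 -> cell n.+1 -> R) :
  \sum_u \sum_(v | grid_edge u v) G u v =
  \sum_(0 <= i < n.+1) \sum_(0 <= j < n) G (icell n i j) (icell n i j.+1) +
  \sum_(0 <= j < n.+1) \sum_(0 <= i < n) G (icell n i j) (icell n i.+1 j).
Proof.
rewrite sum_cell_nat.
have last0 (H : nat -> R) : \sum_(0 <= j < n.+1) (if (j < n)%N then H j else 0) =
    \sum_(0 <= j < n) H j.
  rewrite big_nat_recr //= ltnn addr0.
  by apply: eq_big_nat => j /andP[_ ->].
transitivity (\sum_(0 <= i < n.+1) \sum_(0 <= j < n.+1)
   ((if (j < n)%N then G (icell n i j) (icell n i j.+1) else 0) +
    (if (i < n)%N then G (icell n i j) (icell n i.+1 j) else 0))).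
  by apply: eq_big_nat => i /andP[_ hi]; apply: eq_big_nat => j /andP[_ hj];
    rewrite sum_edges_from.
under eq_bigr do rewrite big_split /= last0.
rewrite big_split /=; congr (_ + _); rewrite exchange_big /=.
by apply: eq_bigr => j _; rewrite last0.
Qed.

Lemma frob2_nat (R : realType) n (A : 'M[R]_n.+1) : frob2 A =
  \sum_(0 <= i < n.+1) \sum_(0 <= j < n.+1) A (inord i) (inord j) ^+ 2.
Proof. by rewrite /frob2 sum_ord_nat; apply: eq_bigr => i _; rewrite sum_ord_nat. Qed.

(** On an edge inside a rectangle [ths] has no increment, so [f] has that of [th]. On any other edge
    the triangle inequality bounds minus the increment of [f] by that of [th] minus that of [ths],
    in absolute values. Summing leaves the difference of the total variations. *)
Lemma TVnorm_cone (R : realType) n k (th ths : 'M[R]_n.+1) (lab : cell n.+1 -> 'I_k) :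
  (forall x y, lab x = lab y -> ths x.1 x.2 = ths y.1 y.2) ->
  TVnorm th <= TVnorm ths ->
  let f i j := (th - ths) (inord i) (inord j) in
  let L i j := lab (icell n i j) in
  \sum_(0 <= i < n.+1) \sum_(0 <= j < n)
    (if L i j == L i j.+1 then `|f i j.+1 - f i j| else - `|f i j.+1 - f i j|) +
  \sum_(0 <= j < n.+1) \sum_(0 <= i < n)
    (if L i j == L i.+1 j then `|f i.+1 j - f i j| else - `|f i.+1 j - f i j|) <= 0.
Proof.
move=> hc; rewrite /TVnorm ler_pM2l ?invr_gt0 ?ltr0n //= => hTV.
pose D (u v : cell n.+1) := `|(th - ths) v.1 v.2 - (th - ths) u.1 u.2|.
rewrite -(sum_edges (fun u v => if lab u == lab v then D u v else - D u v)).
rewrite -subr_le0 -sumrB in hTV; apply: le_trans _ hTV.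
apply: ler_sum => u _; rewrite -sumrB; apply: ler_sum => v _.
rewrite /D !mxE; case: eqP => [/hc ->|_].
  rewrite subrr normr0 subr0 distrC le_eqVlt; apply/orP; left; apply/eqP.
  by congr `|_|; ring.
set p := th u.1 u.2; set q := th v.1 v.2; set p' := ths u.1 u.2; set q' := ths v.1 v.2.
have := ler_normB (p - q) (p - q - (p' - q')).
have -> : p - q - (p - q - (p' - q')) = p' - q' by ring.
have -> : p - q - (p' - q') = - (q - q' - (p - p')) by ring.
by rewrite normrN; lra.
Qed.

Lemma sqr_le_of_le_sqrt (R : realType) (F B : R) : 0 <= F -> 0 <= B ->
  F <= B * Num.sqrt F -> F <= B ^+ 2.
Proof.
move=> F0 B0; rewrite -{1}(sqr_sqrtr F0) -{3}(sqr_sqrtr F0) => h.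
have q0 := sqrtr_ge0 F; set q := Num.sqrt F in h q0 *.
rewrite ler_pXn2r ?nnegrE //.
case: (ltrgtP q 0) q0 => // [q0 _|-> //].
by rewrite expr2 ler_pM2r in h.
Qed.

(** With [D = th - ths], the difference of the two squared distances is exactly
    [|D|^2 - 2 sigma <z, D>]. *)
Lemma observe_basic (R : realType) n sigma (ths : 'M[R]_n.+1) z th :
  frob2 (observe ths sigma z - th) <= frob2 (observe ths sigma z - ths) ->
  frob2 (th - ths) <= 2 * sigma * \sum_(0 <= i < n.+1) \sum_(0 <= j < n.+1)
    z (icell n i j) * (th - ths) (inord i) (inord j).
Proof.
rewrite !frob2_nat -subr_le0 => h; rewrite -subr_le0; apply: le_trans _ h.
rewrite mulr_sumr -!sumrB; apply: ler_sum => i _.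
rewrite mulr_sumr -!sumrB; apply: ler_sum => j _.
rewrite /icell !mxE le_eqVlt; apply/orP; left; apply/eqP; ring.
Qed.

(** Deterministic in the noise: [observe_basic] and [inner_product_bound] give [|D|^2 <= B * |D|],
    hence [|D|^2 <= B^2]. *)
Lemma tvd_error_bound (R : realType) n k T (ths th : 'M[R]_n.+1)
    (lab : cell n.+1 -> 'I_k) (c sigma M : R) (z : cell n.+1 -> R) :
  0 <= c -> 0 <= sigma -> 0 <= M -> (n.+1 < 2 ^ T)%N ->
  (forall x y, lab x = lab y -> ths x.1 x.2 = ths y.1 y.2) ->
  (forall l, exists a b c' d, is_rect (fun x => lab x = l) a b c' d /\
     aspect a b c' d <= c) ->
  block_bounded n.+1 (fun i j => z (icell n i j)) M ->
  TVnorm th <= TVnorm ths ->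
  frob2 (observe ths sigma z - th) <= frob2 (observe ths sigma z - ths) ->
  frob2 (th - ths) <=
    (2 * sigma * ((3 * T + 1)%:R ^+ 2 * T%:R * (6 + 4 * Num.sqrt c) *
      Num.sqrt (Num.sqrt n.+1%:R) * Num.sqrt k%:R * M)) ^+ 2.
Proof.
move=> c0 s0 M0 hT hc hR hz hTV hy.
have /choice[rc hrc] : forall l, exists r : nat * nat * nat * nat,
    is_rect (fun x => lab x = l) r.1.1.1 r.1.1.2 r.1.2 r.2 /\
    aspect r.1.1.1 r.1.1.2 r.1.2 r.2 <= c.
  by move=> l; have [a [b [c' [d h]]]] := hR l; exists (a, b, c', d).
pose a l := (rc l).1.1.1; pose b l := (rc l).1.1.2.
pose c' l := (rc l).1.2; pose d l := (rc l).2.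
have hL : rect_labels n (fun i j => lab (icell n i j)) a b c' d.
  split=> l; first by have [[/andP[? ?] /andP[? ?] _] _] := hrc l; split.
  move=> i j hi hj; have [[_ _ h] _] := hrc l.
  by apply/eqP/idP => [/h|h']; [|apply/h]; rewrite /icell /= !inordK.
have hA l : (b l - a l).+1%:R <= c * (d l - c' l).+1%:R /\
    (d l - c' l).+1%:R <= c * (b l - a l).+1%:R.
  have [_] := hrc l; rewrite /aspect ge_max => /andP[].
  by rewrite !ler_pdivrMr ?ltr0n.
set f := fun i j => (th - ths) (inord i) (inord j).
have := inner_product_bound (f := f) M0 hz hT hL c0 (fun l => (hA l).1)
  (fun l => (hA l).2) (TVnorm_cone hc hTV).
rewrite -frob2_nat; set K := (_ * M); set F := frob2 _ => hI.
have F0 : 0 <= F.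
  by apply: sumr_ge0 => i _; apply: sumr_ge0 => j _; exact: sqr_ge0.
have K0 : 0 <= K by rewrite /K !mulr_ge0 ?sqr_ge0 ?sqrtr_ge0 ?addr_ge0 ?mulr_ge0 ?sqrtr_ge0.
apply: sqr_le_of_le_sqrt; rewrite ?mulr_ge0 //.
apply: le_trans (observe_basic hy) _; rewrite -[leRHS]mulrA ler_wpM2l ?mulr_ge0 //.
exact: le_trans (ler_norm _) hI.
Qed.

(** * Gaussian expectations *)

(** The integral of a nonnegative function is a supremum over simple functions below it, so no
    measurability is required. This allows an estimator that is not assumed measurable. *)
Lemma ge0_integral_mono d (T : measurableType d) (R : realType)
    (mu : {measure set T -> \bar R}) (f g : T -> \bar R) :
  (forall x, 0 <= f x)%E -> (forall x, f x <= g x)%E ->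
  (\int[mu]_x f x <= \int[mu]_x g x)%E.
Proof.
move=> f0 fg; have g0 x : (0 <= g x)%E by exact: le_trans (f0 x) (fg x).
rewrite !ge0_integralTE //; apply: ereal_sup_le.
by move=> _ [h hf <-]; exists h => // x; exact: le_trans (hf x) (fg x).
Qed.

Lemma gauss_iter_ge0 (R : realType) (T : eqType) (s : seq T)
    (f : (T -> R) -> \bar R) z :
  (forall z, 0 <= f z)%E -> (0 <= gauss_iter s f z)%E.
Proof.
move=> f0; elim: s z => [|x s IH] z //=; apply: integral_ge0 => t _.
by rewrite mule_ge0 // lee_fin normal_pdf_ge0.
Qed.

Lemma gauss_iter_mono (R : realType) (T : eqType) (s : seq T)
    (f g : (T -> R) -> \bar R) z :
  (forall z, 0 <= f z)%E -> (forall z, f z <= g z)%E ->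
  (gauss_iter s f z <= gauss_iter s g z)%E.
Proof.
move=> f0 fg; elim: s z => [|x s IH] z //=.
have p0 t : (0 <= (normal_pdf (0 : R) 1 t)%:E)%E by rewrite lee_fin normal_pdf_ge0.
apply: ge0_integral_mono => t; first by rewrite mule_ge0 // gauss_iter_ge0.
exact: lee_wpmul2l.
Qed.

(** Completing the square in the exponent. *)
Lemma normal_pdf_tilt (R : realType) (b t : R) :
  normal_pdf 0 1 t * expR (b * t) = expR (b ^+ 2 / 2) * normal_pdf b 1 t.
Proof.
rewrite !normal_pdfE ?oner_eq0 // /normal_fun -!mulrA [RHS]mulrCA; congr (_ * _).
by rewrite -!expRD; congr expR; field.
Qed.

Lemma integral_normal_expR (R : realType) (b : R) :
  (\int[@lebesgue_measure R]_t (normal_pdf 0 1 t * expR (b * t))%:E =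
  (expR (b ^+ 2 / 2))%:E)%E.
Proof.
under eq_integral do rewrite normal_pdf_tilt EFinM.
rewrite ge0_integralZl_EFin ?expR_ge0 //.
- by rewrite integral_normal_pdf mule1.
- by move=> t _; rewrite lee_fin normal_pdf_ge0.
- by apply/measurable_EFinP; exact: measurable_normal_pdf.
Qed.

Lemma integral_normal_expR_sum (R : realType) (I : Type) (r : seq I) (c a b : I -> R) :
  (forall i, 0 <= c i) ->
  (\int[@lebesgue_measure R]_(t in [set: R]) ((normal_pdf 0 1 t)%:E *
    (\sum_(i <- r) c i * expR (a i + b i * t))%:E) =
  (\sum_(i <- r) c i * expR (a i + b i ^+ 2 / 2))%:E)%E.
Proof.
move=> c0; pose k i := c i * expR (a i).
have k0 i : 0 <= k i by rewrite mulr_ge0 // expR_ge0.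
have m0 i : measurable_fun [set: R] (fun t => (normal_pdf 0 1 t * expR (b i * t))%:E).
  apply/measurable_EFinP; apply: measurable_funM; first exact: measurable_normal_pdf.
  by apply: measurableT_comp => //; exact: measurable_funM.
transitivity (\int[@lebesgue_measure R]_t
    \sum_(i <- r) ((k i)%:E * (normal_pdf 0 1 t * expR (b i * t))%:E))%E.
  apply: eq_integral => t _; rewrite -EFinM mulr_sumr -sumEFin.
  by apply: eq_bigr => i _; rewrite -EFinM /k expRD; congr (_%:E); ring.
rewrite ge0_integral_sum //; first last.
- move=> i t _; rewrite -EFinM lee_fin mulr_ge0 // mulr_ge0 ?expR_ge0 //.
  exact: normal_pdf_ge0.
- by move=> i; exact: (measurable_funeM (k i)%:E (m0 i)).
rewrite -sumEFin; apply: eq_bigr => i _; rewrite ge0_integralZl_EFin //.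
- by rewrite integral_normal_expR -EFinM /k -mulrA -expRD.
- by move=> t _; rewrite lee_fin mulr_ge0 ?expR_ge0 // normal_pdf_ge0.
- exact: m0.
Qed.

(** Sums of exponentials of linear forms are stable under integration of one Gaussian coordinate,
    which turns [w x * z x] into [w x ^ 2 / 2]. The iterated integral is thus computed without
    exchanging integrals. *)
Lemma gauss_iter_expR_sum (R : realType) (T : finType) (I : Type) (r : seq I)
    (c : I -> R) (w : I -> T -> R) (s : seq T) z :
  (forall i, 0 <= c i) -> uniq s ->
  gauss_iter s (fun z => (\sum_(i <- r) c i * expR (\sum_x w i x * z x))%:E) z =
  (\sum_(i <- r) c i * expR (\sum_x (if x \in s then w i x ^+ 2 / 2
    else w i x * z x)))%:E.
Proof.
move=> c0; elim: s z => [|x s IH] z //= /andP[xs us].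
pose a i := \sum_(y | y != x) (if y \in s then w i y ^+ 2 / 2 else w i y * z y).
transitivity (\int[@lebesgue_measure R]_(t in [set: R]) ((normal_pdf 0 1 t)%:E *
    (\sum_(i <- r) c i * expR (a i + w i x * t))%:E))%E.
  apply: eq_integral => t _; rewrite IH //; congr (_ * _%:E)%E.
  apply: eq_bigr => i _; congr (_ * expR _).
  rewrite (bigD1 x) //= (negbTE xs) eqxx addrC; congr (_ + _).
  by apply: eq_bigr => y /negbTE ->.
rewrite integral_normal_expR_sum //; congr (_%:E); apply: eq_bigr => i _.
congr (_ * expR _); rewrite [RHS](bigD1 x) //= inE eqxx addrC; congr (_ + _).
by apply: eq_bigr => y /negbTE yx; rewrite inE yx.
Qed.

Lemma gauss_expect_expR_sum (R : realType) (T : finType) (I : Type) (r : seq I)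
    (c : I -> R) (w : I -> T -> R) : (forall i, 0 <= c i) ->
  gauss_expect (fun z => (\sum_(i <- r) c i * expR (\sum_x w i x * z x))%:E) =
  (\sum_(i <- r) c i * expR (\sum_x w i x ^+ 2 / 2))%:E.
Proof.
move=> c0; rewrite /gauss_expect gauss_iter_expR_sum ?enum_uniq //.
congr (_%:E); apply: eq_bigr => i _; congr (_ * expR _); apply: eq_bigr => x _.
by rewrite mem_enum.
Qed.

(** * Maximum of the normalised block sums of the noise *)

(** Codes [((first row, rows), (first column, columns))], [(n + 2) ^ 4] in number. Codes of empty
    blocks or of blocks leaving the grid get zero coefficients in [block_coef]. *)
Local Notation block n := (('I_n.+2 * 'I_n.+2) * ('I_n.+2 * 'I_n.+2))%type.

Definition in_block n (B : block n) (x : cell n.+1) : bool :=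
  [&& (0 < B.1.2)%N, (0 < B.2.2)%N, (B.1.1 + B.1.2 <= n.+1)%N, (B.2.1 + B.2.2 <= n.+1)%N,
   (B.1.1 <= x.1 < B.1.1 + B.1.2)%N & (B.2.1 <= x.2 < B.2.1 + B.2.2)%N].

Definition block_coef (R : realType) n (B : block n) (x : cell n.+1) : R :=
  if in_block B x then (Num.sqrt (B.1.2%:R * B.2.2%:R))^-1 else 0.

Lemma sum_in_block (R : realType) n (B : block n) (g : cell n.+1 -> R) :
  (0 < B.1.2)%N -> (0 < B.2.2)%N -> (B.1.1 + B.1.2 <= n.+1)%N -> (B.2.1 + B.2.2 <= n.+1)%N ->
  \sum_x (if in_block B x then g x else 0) =
  blocksum (fun i j => g (icell n i j)) B.1.1 B.1.2 B.2.1 B.2.2.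
Proof.
case: B => -[[i ?] [r ?]] [[j ?] [w ?]] /= r0 w0 hi hj.
rewrite sum_cell_nat /in_block /= r0 w0 hi hj /=.
transitivity (\sum_(0 <= p < n.+1) (if (i <= p <= (i + r).-1)%N then
   \sum_(j <= q < j + w) g (icell n p q) else 0)).
  apply: eq_big_nat => p hp.
  transitivity (\sum_(0 <= q < n.+1) (if (j <= q <= (j + w).-1)%N then
     (if (i <= p <= (i + r).-1)%N then g (icell n p q) else 0) else 0)).
    apply: eq_big_nat => q hq; rewrite !inordK //.
    have -> : (i <= p < i + r)%N = (i <= p <= (i + r).-1)%N by lia.
    have -> : (j <= q < j + w)%N = (j <= q <= (j + w).-1)%N by lia.
    by case: (i <= p <= _)%N; case: (j <= q <= _)%N.
  rewrite sum_if_range; [|lia|lia].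
  have -> : (j + ((j + w).-1 - j).+1 = j + w)%N by lia.
  by case: ifP => // _; rewrite big1.
rewrite sum_if_range; [|lia|lia].
by have -> : (i + ((i + r).-1 - i).+1 = i + r)%N by lia.
Qed.

Lemma block_coef_norm (R : realType) n (B : block n) :
  \sum_x block_coef R B x ^+ 2 <= 1.
Proof.
case: (boolP [&& (0 < B.1.2)%N, (0 < B.2.2)%N, (B.1.1 + B.1.2 <= n.+1)%N
   & (B.2.1 + B.2.2 <= n.+1)%N]) => [/and4P[h1 h2 h3 h4]|h]; last first.
  rewrite big1 // => x _; rewrite /block_coef; case: ifP; last by rewrite expr0n.
  by case/and5P=> h1 h2 h3 h4 _; rewrite h1 h2 h3 h4 in h.
have p0 : 0 < B.1.2%:R * B.2.2%:R :> R by rewrite mulr_gt0 // ltr0n.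
rewrite (eq_bigr (fun x => if in_block B x then (B.1.2%:R * B.2.2%:R)^-1 else 0 : R)).
  rewrite sum_in_block // /blocksum !sumr_const_nat !addKn.
  by rewrite -mulrnA -[_ *+ _]mulr_natl natrM [X in X * _]mulrC divff // gt_eqF.
move=> x _; rewrite /block_coef; case: ifP => _; last by rewrite expr0n.
by rewrite exprVn sqr_sqrtr // ltW.
Qed.

Definition block_stat (R : realType) n (z : cell n.+1 -> R) (B : block n) : R :=
  \sum_x block_coef R B x * z x.

Lemma block_bounded_stat (R : realType) n (z : cell n.+1 -> R) (M : R) :
  0 <= M -> (forall B : block n, `|block_stat z B| <= M) ->
  block_bounded n.+1 (fun i j => z (icell n i j)) M.
Proof.
move=> M0 h i r j w hi hj.
have q0 : 0 <= M * Num.sqrt (r%:R * w%:R) by rewrite mulr_ge0 // sqrtr_ge0.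
case: (posnP r) => [r0|r0]; first by rewrite {1}r0 /blocksum addn0 big_geq // normr0.
case: (posnP w) => [w0|w0].
  by rewrite /blocksum big1 ?normr0 // => p _; rewrite w0 addn0 big_geq.
have [h1 h2 h3 h4] : [/\ i < n.+2, r < n.+2, j < n.+2 & w < n.+2]%N by split; lia.
have := h ((Ordinal h1, Ordinal h2), (Ordinal h3, Ordinal h4)).
have p0 : 0 < r%:R * w%:R :> R by rewrite mulr_gt0 // ltr0n.
rewrite -ler_pdivrMr ?sqrtr_gt0 // -[X in _ / X]ger0_norm ?sqrtr_ge0 // -normf_div.
rewrite -(@sum_in_block _ _ ((Ordinal h1, Ordinal h2), (Ordinal h3, Ordinal h4))) //.
rewrite mulr_suml /block_stat => h'; apply: le_trans _ h'.
rewrite le_eqVlt; apply/orP; left; apply/eqP; congr `|_|; apply: eq_bigr => x _.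
by rewrite /block_coef; case: ifP => _ /=; rewrite ?mul0r // mulrC.
Qed.

(** Square [|x| <= L + exp (|x| - L)]. The exponentials can be summed over all blocks and have
    explicit Gaussian expectations, which replaces a tail bound for the maximum. *)
Lemma sqr_le_expR (R : realType) (L x : R) : 0 <= L ->
  x ^+ 2 <= 2 * L ^+ 2 + 2 * expR (- (2 * L)) * (expR (2 * x) + expR (- (2 * x))).
Proof.
move=> L0; have e1 : `|x| <= L + expR (`|x| - L).
  by have := expR_ge1Dx (`|x| - L); lra.
have e0 := expR_ge0 (`|x| - L).
have e2 : expR (`|x| - L) ^+ 2 <= expR (- (2 * L)) * (expR (2 * x) + expR (- (2 * x))).
  have -> : expR (`|x| - L) ^+ 2 = expR (- (2 * L)) * expR (2 * `|x|).
    by rewrite -expRM_natl -expRD; congr expR; ring.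
  rewrite ler_wpM2l ?expR_ge0 //; case: (ger0P x) => _; rewrite ?mulrN.
    by rewrite lerDl expR_ge0.
  by rewrite lerDr expR_ge0.
rewrite -[x ^+ 2]real_normK ?num_real //.
set E := expR (`|x| - L) in e1 e0 e2 *.
apply: (@le_trans _ _ ((L + E) ^+ 2)).
  by rewrite ler_pXn2r ?nnegrE ?addr_ge0.
by have := sqr_ge0 (L - E); move: e2; lra.
Qed.

(** [None] indexes the constant term of [sqr_le_expR], [Some (B, s)] the exponential of block [B]
    with sign [s]. For this [L], [expR (- (2 * L))] is the inverse of the number of blocks. *)
Definition majorant_weight (R : realType) n (i : option (block n * bool)) : R :=
  let L := 2 * ln n.+2%:R in
  if i is Some _ then 2 * expR (- (2 * L)) else 2 * L ^+ 2.

Definition majorant_coef (R : realType) n (i : option (block n * bool)) (x : cell n.+1) : R :=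
  if i is Some (B, s) then (if s then 2 else -2) * block_coef R B x else 0.

Definition majorant_index n : seq (option (block n * bool)) :=
  None :: map Some (index_enum (block n * bool)%type).

Definition stat_majorant (R : realType) n (z : cell n.+1 -> R) : R :=
  \sum_(i <- majorant_index n)
    majorant_weight R i * expR (\sum_x majorant_coef R i x * z x).

Lemma majorant_weight_ge0 (R : realType) n (i : option (block n * bool)) :
  0 <= majorant_weight R i.
Proof. by case: i => [i|] /=; rewrite mulr_ge0 ?expR_ge0 ?sqr_ge0. Qed.

Lemma sum_majorant_index (R : realType) n (F : option (block n * bool) -> R) :
  \sum_(i <- majorant_index n) F i =
  F None + \sum_(B : block n) (F (Some (B, true)) + F (Some (B, false))).
Proof.
rewrite big_cons big_map; congr (_ + _).
transitivity (\sum_(B : block n) \sum_(s : bool) F (Some (B, s))).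
  by rewrite pair_bigA; apply: eq_bigr => -[].
by apply: eq_bigr => B _; rewrite big_bool.
Qed.

Lemma block_stat_le (R : realType) n (z : cell n.+1 -> R) (B : block n) :
  block_stat z B ^+ 2 <= stat_majorant z.
Proof.
have L0 : 0 <= 2 * ln n.+2%:R :> R by rewrite mulr_ge0 // ln_ge0 // ler1n.
apply: le_trans (sqr_le_expR (block_stat z B) L0) _.
rewrite /stat_majorant sum_majorant_index; apply: lerD.
  by rewrite /= big1 ?expR0 ?mulr1 // => x _; rewrite mul0r.
rewrite (bigD1 B) //= -[leLHS]addr0; apply: lerD; last first.
  by apply: sumr_ge0 => C _; rewrite addr_ge0 // !mulr_ge0 // expR_ge0.
rewrite mulrDr /block_stat; apply: lerD.
  by under [X in _ <= _ * expR X]eq_bigr do rewrite -mulrA; rewrite -mulr_sumr.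
under [X in _ <= _ * expR X]eq_bigr do rewrite -mulrA.
by rewrite -mulr_sumr mulNr.
Qed.

(** Each exponential has expectation at most [expR 2] by [block_coef_norm], and the weights cancel
    the number of blocks. *)
Lemma gauss_expect_majorant (R : realType) n (K : R) : 0 <= K ->
  (gauss_expect (fun z : cell n.+1 -> R => (K * stat_majorant z)%:E) <=
  (K * (8 * ln n.+2%:R ^+ 2 + 4 * expR 2))%:E)%E.
Proof.
move=> K0.
(* With [K] absorbed in the weights, [gauss_expect_expR_sum] applies and linearity of [gauss_expect]
   is avoided. *)
have -> : (fun z : cell n.+1 -> R => (K * stat_majorant z)%:E) = fun z =>
    (\sum_(i <- majorant_index n) (K * majorant_weight R i) *
       expR (\sum_x majorant_coef R i x * z x))%:E.
  apply: boolp.funext => z; congr (_%:E); rewrite /stat_majorant mulr_sumr.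
  by apply: eq_bigr => i _; rewrite mulrA.
rewrite gauss_expect_expR_sum; last first.
  by move=> i; rewrite mulr_ge0 // majorant_weight_ge0.
rewrite lee_fin.
under eq_bigr do rewrite -mulrA.
rewrite -mulr_sumr ler_wpM2l // sum_majorant_index.
have hs (B : block n) (s : bool) :
    expR (\sum_x majorant_coef R (Some (B, s)) x ^+ 2 / 2) <= expR 2.
  rewrite ler_expR (eq_bigr (fun x => 2 * block_coef R B x ^+ 2)).
    by rewrite -mulr_sumr -[leRHS]mulr1 ler_wpM2l // block_coef_norm.
  by move=> x _ /=; case: s; field.
apply: lerD.
  rewrite big1 ?expR0 ?mulr1; last by move=> x _; rewrite /= expr0n mul0r.
  by rewrite /=; lra.
set L := 2 * ln n.+2%:R : R.
apply: (@le_trans _ _ (\sum_(B : block n) 4 * expR (- (2 * L)) * expR 2)).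
  apply: ler_sum => B _; rewrite /= -/L.
  have := ler_wpM2l (expR_ge0 (- (2 * L))) (hs B true).
  have := ler_wpM2l (expR_ge0 (- (2 * L))) (hs B false).
  rewrite /=; lra.
rewrite sumr_const cardT -cardE !card_prod !card_ord.
have -> : expR (- (2 * L)) = (n.+2%:R ^+ 4)^-1.
  rewrite expRN /L mulrA -natrM expRM_natl lnK // posrE ltr0n //.
rewrite -[_ *+ (_ * _)]mulr_natl !natrM.
have h : n.+2%:R != 0 :> R by rewrite pnatr_eq0.
by rewrite le_eqVlt; apply/orP; left; apply/eqP; field.
Qed.

(** Taking for [M] the square root of [stat_majorant] bounds the error pointwise by an integrand of
    known expectation. *)
Lemma tvd_expect_bound (R : realType) n k T (ths : 'M[R]_n.+1)
    (est : 'M[R]_n.+1 -> 'M[R]_n.+1) (lab : cell n.+1 -> 'I_k) (c sigma : R) :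
  0 <= c -> 0 <= sigma -> (n.+1 < 2 ^ T)%N ->
  (forall x y, lab x = lab y -> ths x.1 x.2 = ths y.1 y.2) ->
  (forall l, exists a b c' d, is_rect (fun x => lab x = l) a b c' d /\
     aspect a b c' d <= c) ->
  is_constrained_TVD (TVnorm ths) est ->
  (gauss_expect (fun z => (frob2 (est (observe ths sigma z) - ths))%:E) <=
  ((2 * sigma * ((3 * T + 1)%:R ^+ 2 * T%:R * (6 + 4 * Num.sqrt c) *
      Num.sqrt (Num.sqrt n.+1%:R) * Num.sqrt k%:R)) ^+ 2 *
   (8 * ln n.+2%:R ^+ 2 + 4 * expR 2))%:E)%E.
Proof.
move=> c0 s0 hT hc hR hest; set K := 2 * sigma * _.
apply: le_trans _ (gauss_expect_majorant n (sqr_ge0 K)).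
apply: gauss_iter_mono => z.
  rewrite lee_fin; apply: sumr_ge0 => i _; apply: sumr_ge0 => j _; exact: sqr_ge0.
rewrite lee_fin; have G0 : 0 <= stat_majorant z.
  by apply: le_trans (sqr_ge0 _) (block_stat_le z ((ord0, ord0), (ord0, ord0))).
have [h1 h2] := hest (observe ths sigma z).
have hz : block_bounded n.+1 (fun i j => z (icell n i j)) (Num.sqrt (stat_majorant z)).
  apply: block_bounded_stat; first exact: sqrtr_ge0.
  by move=> B; rewrite -sqrtr_sqr ler_wsqrtr // block_stat_le.
have := tvd_error_bound c0 s0 (sqrtr_ge0 _) hT hc hR hz h1 (h2 _ (lexx _)).
by rewrite !mulrA -(mulrA 2) exprMn sqr_sqrtr // /K !mulrA.
Qed.

(** * Logarithms, powers and the final constant *)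

Lemma half_le_ln2 (R : realType) : 1 / 2 <= ln 2 :> R.
Proof.
have := @le_ln1Dx R (- (1 / 2)); have -> : 1 + - (1 / 2) = 2^-1 :> R by field.
by rewrite lnV ?posrE // => h; have := h ltac:(lra); lra.
Qed.

(** [T] is one more than the integer part of the binary logarithm. The factor 2 comes from
    [ln 2 >= 1 / 2]; the [e] inside the logarithm absorbs the added unit. *)
Lemma exists_log_bound (R : realType) n :
  exists2 T, (n.+1 < 2 ^ T)%N & T%:R <= 2 * ln (expR 1 * n.+1%:R) :> R.
Proof.
exists (trunc_log 2 n.+1).+1; first exact: trunc_log_ltn.
have h : (2 ^ trunc_log 2 n.+1 <= n.+1)%N by apply: trunc_logP.
rewrite lnM ?posrE ?expR_gt0 ?ltr0n // expRK.
move: (trunc_log 2 n.+1) h => t h.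
have : ln ((2 ^ t)%:R) <= ln n.+1%:R :> R.
  by rewrite ler_ln ?posrE ?ltr0n ?expn_gt0 // ler_nat.
rewrite natrX lnXn // -[ln 2 *+ t]mulr_natr => h'.
have := ler_wpM2r (ler0n R t) (half_le_ln2 R); rewrite -[t.+1%:R]nat1r; lra.
Qed.

Lemma sqrt_div_sqr_powR (R : realType) n :
  Num.sqrt n.+1%:R / (n.+1 ^ 2)%:R = ((n.+1 ^ 2)%:R `^ (3 / 4))^-1 :> R.
Proof.
set x := n.+1%:R : R.
have x0 : 0 < x by rewrite ltr0n.
rewrite natrX -/x -powR12_sqrt ?(ltW x0) // -[x ^+ 2]powR_mulrn ?(ltW x0) //.
rewrite -powRrM.
have -> : 2%:R * (3 / 4) = 3 / 2 :> R by field.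
have -> : x `^ 2%:R = x `^ 2^-1 * x `^ (3 / 2).
  rewrite -powRD; last by rewrite (gt_eqF x0) implybT.
  by congr (_ `^ _); field.
by rewrite invfM mulrA divff ?mul1r // gt_eqF // powR_gt0.
Qed.

Unset Implicit Arguments.

Theorem theorem2p2 (R : realType) (c : R) (hc : 0 < c) :
  exists C : R, 0 < C /\
  forall (n : nat) (sigma : R) (thstar : 'M[R]_n)
         (est : 'M[R]_n -> 'M[R]_n),
    (0 < n)%N -> 0 < sigma ->
    (exists lab : cell n -> 'I_(kpart thstar),
        const_rect_partition thstar lab /\
        forall l : 'I_(kpart thstar), exists a b c' d,
          is_rect (fun x => lab x = l) a b c' d /\ aspect a b c' d <= c) ->
    is_constrained_TVD (TVnorm thstar) est ->
    (MSE est thstar sigma <=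
      (C * sigma ^+ 2 * (ln (expR 1 * n%:R)) ^+ 9 *
       ((kpart thstar)%:R `^ (5 / 4)) / ((n ^ 2)%:R `^ (3 / 4)))%:E)%E.
Proof.
set A := 6 + 4 * Num.sqrt c : R.
have A0 : 0 < A by rewrite /A ltr_pwDl // mulr_ge0 // sqrtr_ge0.
(* [4] and [A ^+ 2] come from squaring [2 * sigma] and [6 + 4 * sqrt c], [7 ^+ 4] and [2 ^+ 2] from
   [3 * T + 1 <= 7 * l] and [T <= 2 * l], the last factor from the expectation of the majorant. *)
exists (4 * (7 ^+ 4 * 2 ^+ 2 * A ^+ 2) * (8 + 4 * expR 2)); split.
  have e0 : 0 < 8 + 4 * expR 2 :> R by have := expR_gt0 (2 : R); lra.
  by rewrite mulr_gt0 // mulr_gt0 // mulr_gt0 ?exprn_gt0 // mulr_gt0 ?exprn_gt0.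
move=> [//|n] sigma ths est _ s0 [lab [[_ hconst] hR]] hest.
have [T hT hTl] := exists_log_bound R n.
have := tvd_expect_bound (ltW hc) (ltW s0) hT hconst hR hest.
set k := kpart ths in lab hconst hR *; set l := ln _ in hTl *.
have n0 : 0 < n.+1%:R :> R by rewrite ltr0n.
have l1 : 1 <= l.
  by rewrite /l lnM ?posrE ?expR_gt0 // expRK lerDl ln_ge0 // ler1n.
(* [n + 2 <= 2 * (n + 1) <= e * (n + 1)]. *)
have hln : ln n.+2%:R <= l.
  rewrite /l ler_ln ?posrE ?mulr_gt0 ?expR_gt0 //.
  have := ler_wpM2r (ltW n0) (expR_ge1Dx (1 : R)).
  by rewrite -[n.+2%:R]nat1r -[n.+1%:R]nat1r; have := ler0n R n; lra.
have k1 : 1 <= k%:R :> R.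
  by rewrite ler1n; case: (k) (lab (ord0, ord0)) => // -[].
move=> hE; rewrite /MSE.
have i0 : 0 <= (n.+1 ^ 2)%:R^-1 :> R by rewrite invr_ge0.
apply: le_trans (lee_wpmul2l _ hE) _; first by rewrite lee_fin.
rewrite -EFinM lee_fin -/A.
have l0 : 0 <= l by exact: le_trans l1.
have e1 : (3 * T + 1)%:R ^+ 4 <= (7 * l) ^+ 4.
  by rewrite ler_pXn2r ?nnegrE ?mulr_ge0 // natrD natrM; lra.
have e2 : T%:R ^+ 2 <= (2 * l) ^+ 2 by rewrite ler_pXn2r ?nnegrE ?mulr_ge0.
have e3 : 8 * ln n.+2%:R ^+ 2 + 4 * expR 2 <= (8 + 4 * expR 2) * l ^+ 2.
  have : ln n.+2%:R ^+ 2 <= l ^+ 2 by rewrite ler_pXn2r ?nnegrE // ln_ge0 // ler1n.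
  have : expR 2 <= expR 2 * l ^+ 2.
    rewrite ler_peMr ?expR_ge0 ?exprn_ege1 //.
  lra.
(* The argument yields [k] and [l ^+ 8]; both bases are at least 1, so the exponents may be raised
   to [5 / 4] and 9. *)
have e4 : k%:R <= k%:R `^ (5 / 4) :> R.
  rewrite -[leLHS]powRr1 ?ler0n //; apply: ler_powR => //; lra.
have e5 : l ^+ 8 <= l ^+ 9 by apply: ler_weXn2l.
set E := 8 * _ + _ in e3 *.
set P := _ `^ (5 / 4) in e4 *.
rewrite -(sqrt_div_sqr_powR R n).
set D := (n.+1 ^ 2)%:R^-1 in i0 *.
set S := Num.sqrt n.+1%:R.
have S0 : 0 <= S by exact: sqrtr_ge0.
rewrite [leLHS](_ : _ = 4 * A ^+ 2 * sigma ^+ 2 * (S * D) *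
   ((3 * T + 1)%:R ^+ 4 * T%:R ^+ 2 * E * k%:R)); last first.
  rewrite !exprMn (sqr_sqrtr (sqrtr_ge0 _)) (sqr_sqrtr (ler0n _ k)) -/S.
  by ring.
rewrite [leRHS](_ : _ = 4 * A ^+ 2 * sigma ^+ 2 * (S * D) *
   ((7 ^+ 4 * 2 ^+ 2 * (8 + 4 * expR 2)) * l ^+ 9 * P)); last by ring.
apply: ler_wpM2l.
  by rewrite mulr_ge0 ?(mulr_ge0 S0) // mulr_ge0 ?sqr_ge0 // mulr_ge0 ?sqr_ge0.
have E0 : 0 <= E by rewrite /E addr_ge0 // mulr_ge0 ?sqr_ge0 ?expR_ge0.
have q1 := ler_pM (exprn_ge0 4 (ler0n R _)) (exprn_ge0 2 (ler0n R _)) e1 e2.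
have q2 := ler_pM (mulr_ge0 (exprn_ge0 4 (ler0n R _)) (exprn_ge0 2 (ler0n R _))) E0 q1 e3.
apply: ler_pM => //; first by rewrite !mulr_ge0 ?exprn_ge0.
apply: le_trans q2 _.
rewrite [leLHS](_ : _ = 7 ^+ 4 * 2 ^+ 2 * (8 + 4 * expR 2) * l ^+ 8); last by ring.
apply: ler_wpM2l e5; have := expR_ge0 (2 : R); lra.
Qed.
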